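(* Let $G(z)=\sum_{p=0}^{d}z^pA_p+\sum_{j=1}^k w_j(z)E_j$ be an $n\times n$ $*$-palindromic rational matrix polynomial and let $\lambda\in\mathbb{C}\setminus\{0\}$ with $|\lambda|\ne1$ be such that $\lambda$ is not a pole of $G(z)$ and $w_j(\lambda)\ne0$ for $j=1,\ldots,k$. Suppose that $M:=(G(\lambda))^{-1}$ exists. Let $J$ and $H_0,\ldots,H_{d+k}$ be the Hermitian matrices of size $n(d+k+1)$ built from $M$, $\lambda$ and the $w_j(\lambda)$ as defined in the context. Then $$\widehat\lambda_{\max}:=\min_{t_0,\ldots,t_{d+k}\in\mathbb{R}}\lambda_{\max}\left(J+t_0H_0+\cdots+t_{d+k}H_{d+k}\right)$$ is attained for some $(\hat t_0,\ldots,\hat t_{d+k})\in\mathbb{R}^{d+k+1}$, and $\eta^{\mathrm{pal}_*}(G,\lambda)\ge\frac{1}{\sqrt{\widehat\lambda_{\max}}}$. Further, if $\widehat\lambda_{\max}$ is a simple eigenvalue of $J+\hat t_0H_0+\cdots+\hat t_{d+k}H_{d+k}$, then $$\eta^{\mathrm{pal}_*}(G,\lambda)=\frac{1}{\sqrt{\widehat\lambda_{\max}}}.$$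
   Context: A rational matrix polynomial (RMP) is $G(z)=\sum_{p=0}^d z^pA_p+\sum_{j=1}^k w_j(z)E_j$ with $A_p,E_j\in\mathbb{C}^{n\times n}$ and $w_j(z)=s_j(z)/q_j(z)$, where $s_j,q_j$ are scalar polynomials, $q_j\not\equiv0$. The poles of $G(z)$ are the roots of the $q_j$. $G(z)$ is $*$-palindromic if $A_p^*=A_{d-p}$ for $p=0,\ldots,d$, $E_j^*=E_j$ and $\overline{w_j(z)}=\overline{z}^{\,d}w_j(1/\overline z)$ for $j=1,\ldots,k$. $\|\cdot\|$ is the spectral norm. For a tuple of $n\times n$ matrices, the tuple norm is $$|||(\Delta A_0,\ldots,\Delta A_d,\Delta E_1,\ldots,\Delta E_k)|||:=\sqrt{\textstyle\sum_{p=0}^d\|\Delta A_p\|^2+\sum_{j=1}^k\|\Delta E_j\|^2}.$$ For $\mathbb{S}\subseteq(\mathbb{C}^{n\times n})^{d+k+1}$ the structured eigenvalue backward error $\eta^{\mathbb{S}}(G,\lambda)$ is the infimum of $|||(\Delta A_0,\ldots,\Delta E_k)|||$ over all $(\Delta A_0,\ldots,\Delta A_d,\Delta E_1,\ldots,\Delta E_k)\in\mathbb{S}$ with $$\det\Big(\sum_{p=0}^d\lambda^p(A_p-\Delta A_p)+\sum_{j=1}^kw_j(\lambda)(E_j-\Delta E_j)\Big)=0.$$ $\eta^{\mathrm{pal}_*}(G,\lambda)$ denotes $\eta^{\mathbb{S}}(G,\lambda)$ when $\mathbb{S}$ is the set of tuples with $(\Delta A_p)^*=\Delta A_{d-p}$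 for $p=0,\ldots,d$ and $\Delta E_j^*=\Delta E_j$ for $j=1,\ldots,k$. Definition of $J$ and $H_j$. Let $m:=\lfloor\frac{d-1}{2}\rfloor$, $\Lambda:=[1,\lambda,\ldots,\lambda^d,w_1(\lambda),\ldots,w_k(\lambda)]\in\mathbb{C}^{1\times(d+k+1)}$, and let $e_i$ be the $i$th standard unit vector of $\mathbb{R}^{d+k+1}$. For $j=0,\ldots,m$ let $$\gamma_{j1}:=\sqrt{\tfrac{2}{1+|\lambda|^{d-2j}}},\qquad \gamma_{j2}:=\sqrt{\tfrac{2|\lambda|^{d-2j}}{1+|\lambda|^{d-2j}}}.$$ Let $\Gamma:=\mathrm{diag}(\gamma_{01},\ldots,\gamma_{m1},\gamma_{m2},\ldots,\gamma_{02},1,\ldots,1)\otimes I_n$ if $d$ is odd and $\Gamma:=\mathrm{diag}(\gamma_{01},\ldots,\gamma_{m1},1,\gamma_{m2},\ldots,\gamma_{02},1,\ldots,1)\otimes I_n$ if $d$ is even, where the final block of ones has length $k$. Set $$\widetilde J:=(\Lambda^*\Lambda)\otimes(M^*M),\qquad J:=\Gamma^{-1}\widetilde J\,\Gamma^{-1}.$$ For $p=0,\ldots,m$ set $\widetilde C_p:=\Lambda^*e_{p+1}^*\otimes M^*-e_{d-p+1}\Lambda\otimes M$ and $$H_p:=\Gamma^{-1}(\widetilde C_p+\widetilde C_p^* )\Gamma^{-1},\qquad H_{d-p}:=i\,\Gamma^{-1}(\widetilde C_p-\widetilde C_p^* )\Gamma^{-1}.$$ If $d$ is even set $H_{d/2}:=\Gamma^{-1}\,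 i\big(\Lambda^*e_{d/2+1}^*\otimes M^*-e_{d/2+1}\Lambda\otimes M\big)\Gamma^{-1}$. For $j=1,\ldots,k$ set $$H_{d+j}:=\Gamma^{-1}\, i\big(\Lambda^*e_{d+j+1}^*\otimes M^*-e_{d+j+1}\Lambda\otimes M\big)\Gamma^{-1}.$$ $\lambda_{\max}(H)$ is the largest eigenvalue of a Hermitian matrix $H$; $\otimes$ is the Kronecker product. *)

(* Defs.v *)
From mathcomp Require Import all_boot all_order all_algebra.
From mathcomp Require Import all_classical all_reals ereal.
From mathcomp Require Import complex mxtens.

Set Implicit Arguments.
Unset Strict Implicit.
Unset Printing Implicit Defensive.

Import Order.TTheory GRing.Theory Num.Theory.
Import ComplexField.Normc.

Local Open Scope ring_scope.
Local Open Scope complex_scope.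
Local Open Scope classical_set_scope.

Section SpectralQuantities.
Variable R : realType.
Local Notation C := (R[i]).

Definition adjmx (m n : nat) (A : 'M[C]_(m, n)) : 'M[C]_(n, m) :=
  map_mx Num.conj A^T.

(* Meant for Hermitian matrices of positive size: all eigenvalues are then
   real, the set below is finite and nonempty, and its supremum is its
   largest element. *)
Definition lambda_max (n : nat) (A : 'M[C]_n) : R :=
  sup [set x : R | eigenvalue A x%:C].

Definition simple_eigenvalue (n : nat) (A : 'M[C]_n) (a : C) : Prop :=
  mup a (char_poly A) = 1%N.

Definition spectral_norm (m n : nat) (A : 'M[C]_(m, n)) : R :=
  Num.sqrt (lambda_max (adjmx A *m A)).

End SpectralQuantities.

Section RationalMatrixPolynomials.
Variable R : realType.
Variables n d k : nat.
Local Notation C := (R[i]).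

(* (X_0, ..., X_d; Y_1, ..., Y_k), the index j = 1, ..., k being shifted to
   0, ..., k - 1. *)
Definition mx_tuple : Type :=
  (('I_d.+1 -> 'M[C]_n) * ('I_k -> 'M[C]_n))%type.

Record rmp := RMP {
  rmp_A : 'I_d.+1 -> 'M[C]_n;
  rmp_E : 'I_k -> 'M[C]_n;
  rmp_s : 'I_k -> {poly C};
  rmp_q : 'I_k -> {poly C};
  rmp_q_neq0 : forall j, rmp_q j != 0 }.

Definition rmp_w (G : rmp) (j : 'I_k) (z : C) : C :=
  (rmp_s G j).[z] / (rmp_q G j).[z].

Definition rmp_eval (G : rmp) (z : C) : 'M[C]_n :=
  \sum_(p < d.+1) z ^+ p *: rmp_A G p + \sum_(j < k) rmp_w G j z *: rmp_E G j.

Definition is_pole (G : rmp) (z : C) : Prop := exists j, root (rmp_q G j) z.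

(* For p : 'I_d.+1, the value of rev_ord p is d - p. *)
Definition pal_star : set mx_tuple :=
  [set D | (forall p, adjmx (D.1 p) = D.1 (rev_ord p)) /\
           (forall j, adjmx (D.2 j) = D.2 j)].

(* The functional equation for w_j is an identity of rational functions, so it
   is required only where neither side is evaluated at a root of q_j (or at
   z = 0): elsewhere division by zero would make rmp_w meaningless. *)
Definition star_palindromic (G : rmp) : Prop :=
  pal_star (rmp_A G, rmp_E G) /\
  (forall (j : 'I_k) (z : C), z != 0 ->
     ~~ root (rmp_q G j) z -> ~~ root (rmp_q G j) (1 / Num.conj z) ->
     Num.conj (rmp_w G j z) = Num.conj z ^+ d * rmp_w G j (1 / Num.conj z)).

Definition tuple_norm (D : mx_tuple) : R :=
  Num.sqrt (\sum_(p < d.+1) spectral_norm (D.1 p) ^+ 2 +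
            \sum_(j < k) spectral_norm (D.2 j) ^+ 2).

Definition backward_error (S : set mx_tuple) (G : rmp) (lam : C) : \bar R :=
  ereal_inf [set (tuple_norm D)%:E | D in
    [set D : mx_tuple | S D /\
       \det (\sum_(p < d.+1) lam ^+ p *: (rmp_A G p - D.1 p) +
             \sum_(j < k) rmp_w G j lam *: (rmp_E G j - D.2 j)) = 0]].

Section JandH.
Variables (G : rmp) (lam : C).

Local Notation N := (d.+1 + k)%N.
Local Notation M := (invmx (rmp_eval G lam)).

Definition Lam : 'rV[C]_N :=
  row_mx (\row_(p < d.+1) lam ^+ p) (\row_(j < k) rmp_w G j lam).

(* Positions are 0-based: std_vec i is the vector written e_{i+1}. *)
Definition std_vec (i : 'I_N) : 'cV[C]_N := delta_mx i ord0.

Definition gamma1 (j : nat) : R :=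
  Num.sqrt (2 / (1 + normc lam ^+ (d - 2 * j))).

Definition gamma2 (j : nat) : R :=
  Num.sqrt (2 * normc lam ^+ (d - 2 * j) / (1 + normc lam ^+ (d - 2 * j))).

(* With m = floor((d-1)/2), the condition p <= m reads 2 * p < d (in
   particular there is no such p when d = 0), and the positions after the
   middle carry gamma2 in reverse order. *)
Definition gamma_entry (p : 'I_d.+1) : R :=
  if (2 * p < d)%N then gamma1 p
  else if (2 * p == d)%N then 1
  else gamma2 (d - p).

Definition Gam : 'M[C]_(N * n) :=
  diag_mx (row_mx (\row_(p < d.+1) (gamma_entry p)%:C) (const_mx 1))
    *t (1%:M : 'M[C]_n).

Definition Jtilde : 'M[C]_(N * n) :=
  (adjmx Lam *m Lam) *t (adjmx M *m M).

Definition Jmx : 'M[C]_(N * n) := invmx Gam *m Jtilde *m invmx Gam.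

Definition Cgen (a b : 'I_N) : 'M[C]_(N * n) :=
  (adjmx Lam *m adjmx (std_vec a)) *t adjmx M - (std_vec b *m Lam) *t M.

Definition Ctilde (p : 'I_d.+1) : 'M[C]_(N * n) :=
  Cgen (lshift k p) (lshift k (rev_ord p)).

(* In the third branch p = d - p' with p' = rev_ord p <= m. *)
Definition Hpoly (p : 'I_d.+1) : 'M[C]_(N * n) :=
  if (2 * p < d)%N then
    invmx Gam *m (Ctilde p + adjmx (Ctilde p)) *m invmx Gam
  else if (2 * p == d)%N then
    invmx Gam *m ('i *: Cgen (lshift k p) (lshift k p)) *m invmx Gam
  else
    'i *: (invmx Gam *m (Ctilde (rev_ord p) - adjmx (Ctilde (rev_ord p)))
             *m invmx Gam).

Definition Hrat (j : 'I_k) : 'M[C]_(N * n) :=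
  invmx Gam *m ('i *: Cgen (rshift d.+1 j) (rshift d.+1 j)) *m invmx Gam.

Definition Hmx (i : 'I_N) : 'M[C]_(N * n) :=
  match fintype.split i with inl p => Hpoly p | inr j => Hrat j end.

Definition JH (t : 'I_N -> R) : 'M[C]_(N * n) :=
  Jmx + \sum_(i < N) (t i)%:C *: Hmx i.

End JandH.

End RationalMatrixPolynomials.

(* Main.v *)
Require Import Defs.
From mathcomp Require Import all_boot all_order all_algebra.
From mathcomp Require Import all_classical all_reals ereal.
From mathcomp Require Import complex mxtens.
From mathcomp Require Import ring lra zify.
From mathcomp Require Import filter topology normedtype derive.

Set Implicit Arguments.
Unset Strict Implicit.
Unset Printing Implicit Defensive.
Import Order.TTheory GRing.Theory Num.Theory.
Import numFieldNormedType.Exports.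
Import ComplexField.Normc.
Local Open Scope classical_set_scope.
Local Open Scope ring_scope.
Local Open Scope complex_scope.
Local Notation Re := complex.Re.
Local Notation Im := complex.Im.

(** Write N = d + 1 + k and read a vector of size N * n as a family of blocks
v_q in C^n.  Put x = M (sum_q Lam_q v_q), so that G(lam) x = sum_q Lam_q v_q.
A perturbation (Delta_q) makes lam an eigenvalue iff some x <> 0 satisfies
G(lam) x = sum_q Lam_q (Delta_q x), and then the blocks v_q = Delta_q x give
back this x.  Let sigma exchange p and d - p and fix the rational indices,
and let g_q be the diagonal entry of Gamma on the block q.
The structure demands that Delta_(sigma q) be the adjoint of Delta_q; with
alpha_q = <x, v_q> this forces alpha_(sigma q) = conj alpha_q.  At the vector
Gamma v the quadratic form of J is |x|^2, and those of the H_q are the real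
numbers that vanish exactly when these relations hold (qform_JH, alpha_sym).

Lower bound (lower_bound).  For an admissible Delta the form of
J + sum_q t_q H_q at Gamma v is |x|^2 whatever t is.  Moreover
|Gamma v|^2 = sum_q g_q^2 |Delta_q x|^2 <= |||Delta|||^2 |x|^2, because the
squared weights g_q^2 and g_(sigma q)^2 add up to 2 while Delta_q and
Delta_(sigma q) have equal norms.  Hence 1 <= lambda_max |||Delta|||^2.  Since
the tuple (A, E) is itself admissible, lambda_max is positive.

Attainment (JH_minimizer).  As J is positive semidefinite, lambda_max tends to
infinity with t as soon as sum_q t_q H_q has a positive eigenvalue for every
t <> 0 (lambda_max_pencil_min).  The form of this combination is
2 Re (sum_q tau_q alpha_q), with tau depending linearly and injectively on t,
and it takes positive values unless tau is a multiple of Lam (tau_positive).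
A nonzero multiple is possible only if |lam|^d = 1, that is d = 0, and all
Lam_q are real (tau_parallel).  In that degenerate case G(lam) is Hermitian,
the largest eigenvalue is constant along the direction t = Lam, and one
minimizes on the slice t_0 = 0, where the previous argument applies.

Equality (upper_bound).  At a minimizer whose largest eigenvalue l is simple,
first-order perturbation shows that the unit eigenvector w = Gamma v satisfies
<w, H_q w> = 0 for all q (simple_top_stationary), so that
alpha_(sigma q) = conj alpha_q and |x|^2 = l.  The eigenvector equation says
that v_q is (conj Lam_q / (l g_q^2)) u plus a multiple of x, with u independent
of q.  The weights are chosen so that |Lam_q| / g_q^2 is the same at q and at
sigma q; therefore |v_q| = |v_(sigma q)| (sqn_orth_sym).  This is exactly what
allows a matrix Delta_q of norm |v_q| / |x| that sends x to v_q and whose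
adjoint sends x to v_(sigma q) (interp).  The resulting tuple is structured,
makes lam an eigenvalue, and its squared norm is at most
sum_q |v_q|^2 / |x|^2 = sum_q g_q^2 |v_q|^2 / |x|^2 = 1 / l. *)

(** * Complex numbers and conjugate transposes *)

Section HermitianForms.
Variable R : realType.
Local Notation C := (R[i]).

Lemma le_of_sqr (x y : R) : 0 <= y -> x ^+ 2 <= y ^+ 2 -> x <= y.
Proof.
move=> y0 h; have [x0|x0] := leP 0 x; last exact: le_trans (ltW x0) y0.
by rewrite -(ler_pXn2r (_ : 0 < 2)%N) ?nnegrE.
Qed.

(** The cancellation behind the equality of the norms of v_q and v_(sigma q):
a and b are the two weights, p and r the moduli of the two entries of Lam. *)
Lemma balance_cancel (l a b p r X Y U : R) : 0 < l -> 0 < a -> 0 < b ->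
  p * b ^+ 2 = r * a ^+ 2 ->
  l * a ^+ 2 * (l * a ^+ 2) * X = p ^+ 2 * U ->
  l * b ^+ 2 * (l * b ^+ 2) * Y = r ^+ 2 * U -> X = Y.
Proof.
move=> l0 a0 b0 bal k1 k2.
have lab : 0 < (l * (a * b) ^+ 2) ^+ 2.
  by rewrite exprn_gt0 // mulr_gt0 // exprn_gt0 // mulr_gt0.
have E : (l * (a * b) ^+ 2) ^+ 2 * X = (l * (a * b) ^+ 2) ^+ 2 * Y.
  transitivity (b ^+ 2 * b ^+ 2 * (l * a ^+ 2 * (l * a ^+ 2) * X)); first by ring.
  rewrite k1; transitivity (a ^+ 2 * a ^+ 2 * (l * b ^+ 2 * (l * b ^+ 2) * Y)); last by ring.
  rewrite k2; transitivity ((p * b ^+ 2) ^+ 2 * U); first by ring.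
  by rewrite bal; ring.
by apply: (mulfI _ E); rewrite gt_eqF.
Qed.

Lemma ReD (a b : C) : Re (a + b) = Re a + Re b.
Proof. by case: a => ? ?; case: b. Qed.
Lemma ReN (a : C) : Re (- a) = - Re a. Proof. by case: a. Qed.
Lemma ReZ (a : R) (b : C) : Re (a%:C * b) = a * Re b.
Proof. by case: b => ? ?; rewrite /= mul0r subr0. Qed.
Lemma Re_conj (a : C) : Re (Num.conj a) = Re a. Proof. by case: a. Qed.
Lemma Re_sum I r (P : pred I) (F : I -> C) :
  Re (\sum_(i <- r | P i) F i) = \sum_(i <- r | P i) Re (F i).
Proof. by apply: big_morph => // a b; exact: ReD. Qed.
Lemma conj_mul_self (a : C) : Num.conj a * a = (normc a ^+ 2)%:C.
Proof.
case: a => x y /=; rewrite sqr_sqrtr ?addr_ge0 ?sqr_ge0 //; apply/eqP.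
by rewrite eq_complex /=; apply/andP; split; apply/eqP; ring.
Qed.
Lemma normc_real_sq (a : R) : normc (a%:C : C) ^+ 2 = a ^+ 2.
Proof. by rewrite /= expr0n /= addr0 sqr_sqrtr ?sqr_ge0. Qed.
Lemma conj_real (a : R) : Num.conj (a%:C : C) = a%:C.
Proof. exact: conjc_real. Qed.

Lemma normc_gt0 (z : C) : z != 0 -> 0 < normc z.
Proof. by move=> z0; rewrite -ltcR; have := z0; rewrite -normr_gt0. Qed.

Lemma normcX (z : C) m : normc (z ^+ m) = normc z ^+ m.
Proof.
elim: m => [|m IH]; first by rewrite !expr0 normc1.
by rewrite !exprS normcM IH.
Qed.

Lemma conj_i : Num.conj ('i%C : C) = - 'i%C.
Proof. by apply/eqP; rewrite eq_complex /= oppr0 !eqxx. Qed.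

Lemma conj_i_half : Num.conj ('i%C / 2 : C) = - ('i%C / 2).
Proof. by rewrite fmorph_div rmorph_nat /= conj_i mulNr. Qed.

Lemma adjmxE m n (A : 'M[C]_(m, n)) i j : adjmx A i j = Num.conj (A j i).
Proof. by rewrite !mxE. Qed.
Lemma adjmxK m n (A : 'M[C]_(m, n)) : adjmx (adjmx A) = A.
Proof. by apply/matrixP => i j; rewrite !adjmxE conjCK. Qed.
Lemma adjmxD m n (A B : 'M[C]_(m, n)) : adjmx (A + B) = adjmx A + adjmx B.
Proof. by apply/matrixP => i j; rewrite !(adjmxE, mxE) rmorphD. Qed.
Lemma adjmxN m n (A : 'M[C]_(m, n)) : adjmx (- A) = - adjmx A.
Proof. by apply/matrixP => i j; rewrite !(adjmxE, mxE) rmorphN. Qed.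
Lemma adjmxB m n (A B : 'M[C]_(m, n)) : adjmx (A - B) = adjmx A - adjmx B.
Proof. by rewrite adjmxD adjmxN. Qed.
Lemma adjmxZ m n a (A : 'M[C]_(m, n)) : adjmx (a *: A) = Num.conj a *: adjmx A.
Proof. by apply/matrixP => i j; rewrite !(adjmxE, mxE) rmorphM. Qed.
Lemma adjmxM m n p (A : 'M[C]_(m, n)) (B : 'M_(n, p)) :
  adjmx (A *m B) = adjmx B *m adjmx A.
Proof. by rewrite /adjmx trmx_mul map_mxM. Qed.
Lemma adjmx_sum m n I r (P : pred I) (F : I -> 'M[C]_(m, n)) :
  adjmx (\sum_(i <- r | P i) F i) = \sum_(i <- r | P i) adjmx (F i).
Proof.
apply: (big_morph (@adjmx R m n)); first exact: adjmxD.
by apply/matrixP => i j; rewrite !(adjmxE, mxE) rmorph0.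
Qed.

(** * The inner product and quadratic forms *)

Definition dotc m (u v : 'cV[C]_m) : C := (adjmx u *m v) 0 0.
Definition sqn m (v : 'cV[C]_m) : R := Re (dotc v v).
Definition qform m (A : 'M[C]_m) (v : 'cV[C]_m) : R := Re (dotc v (A *m v)).

Lemma dotcE m (u v : 'cV[C]_m) : dotc u v = \sum_i Num.conj (u i 0) * v i 0.
Proof. by rewrite /dotc mxE; apply: eq_bigr => i _; rewrite adjmxE. Qed.
Lemma dotcDr m (u v w : 'cV[C]_m) : dotc u (v + w) = dotc u v + dotc u w.
Proof. by rewrite /dotc mulmxDr mxE. Qed.
Lemma dotcDl m (u v w : 'cV[C]_m) : dotc (u + v) w = dotc u w + dotc v w.
Proof. by rewrite /dotc adjmxD mulmxDl mxE. Qed.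
Lemma dotcNr m (u v : 'cV[C]_m) : dotc u (- v) = - dotc u v.
Proof. by rewrite /dotc mulmxN mxE. Qed.
Lemma dotcNl m (u v : 'cV[C]_m) : dotc (- u) v = - dotc u v.
Proof. by rewrite /dotc adjmxN mulNmx mxE. Qed.
Lemma dotcBr m (u v w : 'cV[C]_m) : dotc u (v - w) = dotc u v - dotc u w.
Proof. by rewrite dotcDr dotcNr. Qed.
Lemma dotcBl m (u v w : 'cV[C]_m) : dotc (u - v) w = dotc u w - dotc v w.
Proof. by rewrite dotcDl dotcNl. Qed.
Lemma dotcZr m (u v : 'cV[C]_m) a : dotc u (a *: v) = a * dotc u v.
Proof. by rewrite /dotc -scalemxAr mxE. Qed.
Lemma dotcZl m (u v : 'cV[C]_m) a : dotc (a *: u) v = Num.conj a * dotc u v.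
Proof. by rewrite /dotc adjmxZ -scalemxAl mxE. Qed.
Lemma dotc_conj m (u v : 'cV[C]_m) : Num.conj (dotc u v) = dotc v u.
Proof. by rewrite -adjmxE adjmxM adjmxK. Qed.
Lemma dotc_adj m n (A : 'M[C]_(m, n)) u v : dotc u (A *m v) = dotc (adjmx A *m u) v.
Proof. by rewrite /dotc adjmxM adjmxK mulmxA. Qed.
Lemma dotc_sumr m I r (P : pred I) (u : 'cV[C]_m) (F : I -> 'cV[C]_m) :
  dotc u (\sum_(i <- r | P i) F i) = \sum_(i <- r | P i) dotc u (F i).
Proof. by rewrite /dotc mulmx_sumr summxE. Qed.
Lemma dotc0 m (u : 'cV[C]_m) : dotc u 0 = 0.
Proof. by rewrite /dotc mulmx0 mxE. Qed.

Lemma dot0c m (u : 'cV[C]_m) : dotc 0 u = 0.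
Proof. by rewrite -(dotc_conj u) dotc0 conjC0. Qed.

Lemma sqnE m (v : 'cV[C]_m) : sqn v = \sum_i normc (v i 0) ^+ 2.
Proof. by rewrite /sqn dotcE Re_sum; apply: eq_bigr => i _; rewrite conj_mul_self. Qed.
Lemma dotcc m (v : 'cV[C]_m) : dotc v v = (sqn v)%:C.
Proof. by rewrite dotcE sqnE rmorph_sum; apply: eq_bigr => i _; rewrite conj_mul_self. Qed.
Lemma sqn_ge0 m (v : 'cV[C]_m) : 0 <= sqn v.
Proof. by rewrite sqnE sumr_ge0 // => i _; rewrite sqr_ge0. Qed.
Lemma sqn_eq0 m (v : 'cV[C]_m) : (sqn v == 0) = (v == 0).
Proof.
apply/eqP/eqP => [|->]; last by rewrite /sqn dotc0.
rewrite sqnE => /psumr_eq0P h; apply/colP => i; rewrite mxE.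
have /eqP := h (fun i _ => sqr_ge0 _) i isT.
by rewrite sqrf_eq0 => /eqP /eq0_normc.
Qed.
Lemma sqn_gt0 m (v : 'cV[C]_m) : (0 < sqn v) = (v != 0).
Proof. by rewrite lt_def sqn_ge0 sqn_eq0 andbT. Qed.
Lemma sqnZ m a (v : 'cV[C]_m) : sqn (a *: v) = normc a ^+ 2 * sqn v.
Proof. by rewrite /sqn dotcZl dotcZr mulrA conj_mul_self ReZ. Qed.

Lemma Cauchy_Schwarz_Re m (u v : 'cV[C]_m) : Re (dotc u v) ^+ 2 <= sqn u * sqn v.
Proof.
have [->|v0] := eqVneq v 0; first by rewrite dotc0 /= expr0n /= mulr_ge0 ?sqn_ge0.
have vp : 0 < sqn v by rewrite sqn_gt0.
have := sqn_ge0 ((sqn v)%:C *: u - (Re (dotc u v))%:C *: v).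
rewrite {1}/sqn dotcBl !dotcBr !dotcZl !dotcZr !conj_real !dotcc -(dotc_conj u v).
rewrite !(ReD, ReN, ReZ) Re_conj /=.
set r := Re _ ; move=> h.
rewrite -subr_ge0 -(pmulr_rge0 _ vp); nra.
Qed.

Lemma qformD m (A B : 'M[C]_m) v : qform (A + B) v = qform A v + qform B v.
Proof. by rewrite /qform mulmxDl dotcDr ReD. Qed.
Lemma qformZ m a (A : 'M[C]_m) v : qform (a%:C *: A) v = a * qform A v.
Proof. by rewrite /qform -scalemxAl dotcZr ReZ. Qed.
Lemma qform_sum m I r (P : pred I) (F : I -> 'M[C]_m) v :
  qform (\sum_(i <- r | P i) F i) v = \sum_(i <- r | P i) qform (F i) v.
Proof. by rewrite /qform mulmx_suml dotc_sumr Re_sum. Qed.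
Lemma qform_scale m a (A : 'M[C]_m) v : qform A (a *: v) = normc a ^+ 2 * qform A v.
Proof. by rewrite /qform -scalemxAr dotcZl dotcZr mulrA conj_mul_self ReZ. Qed.

Definition hermitianmx m (A : 'M[C]_m) := adjmx A = A.

Lemma herm_skew m c (A B : 'M[C]_m) :
  adjmx A = - B -> adjmx B = - A -> hermitianmx (c *: A - Num.conj c *: B).
Proof.
move=> hA hB; rewrite /hermitianmx adjmxB !adjmxZ hA hB conjCK !scalerN opprK.
by rewrite addrC.
Qed.

Lemma invmx_herm m (A : 'M[C]_m) : A \in unitmx -> hermitianmx A -> hermitianmx (invmx A).
Proof.
move=> uA hA; have : adjmx (invmx A) *m A = 1%:M.
  rewrite -{2}hA -adjmxM mulmxV //.
  by apply/matrixP => i j; rewrite adjmxE !mxE rmorph_nat eq_sym.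
by move/(congr1 (mulmx^~ (invmx A))); rewrite mulmxK // mul1mx.
Qed.

Lemma det0_kernel m (A : 'M[C]_m) : (\det A = 0) <-> exists2 x : 'cV_m, x != 0 & A *m x = 0.
Proof.
rewrite -det_tr; split=> [/eqP/det0P [y y0 yA]|[x x0 Ax]].
  exists y^T; first by rewrite -(inj_eq trmx_inj) trmxK trmx0.
  by apply: trmx_inj; rewrite trmx_mul trmxK yA trmx0.
apply/eqP/det0P; exists x^T; first by rewrite -(inj_eq trmx_inj) trmxK trmx0.
by rewrite -trmx_mul Ax trmx0.
Qed.

Lemma mul_skew m a b (A B : 'M[C]_m) (u : 'cV[C]_m) :
  (a *: A - b *: B) *m u = a *: (A *m u) + (- b) *: (B *m u).
Proof. by rewrite mulmxBl -!scalemxAl scaleNr. Qed.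

(** Each H_q comes from a matrix c A plus its adjoint, with B = - A^H. *)
Lemma qform_skew m c (A B : 'M[C]_m) u x y :
  dotc u (A *m u) = x - Num.conj y -> dotc u (B *m u) = y - Num.conj x ->
  qform (c *: A - Num.conj c *: B) u = 2 * Re (c * (x - Num.conj y)).
Proof.
move=> hA hB; rewrite /qform mulmxBl -!scalemxAl dotcBr !dotcZr hA hB.
have -> : y - Num.conj x = - Num.conj (x - Num.conj y).
  by rewrite rmorphB /= conjCK opprB.
rewrite mulrN opprK; move: (x - _) => z.
have -> : Num.conj c * Num.conj z = Num.conj (c * z) by rewrite rmorphM.
by rewrite ReD Re_conj mulr2n mulrDl mul1r.
Qed.

Lemma qform_add_cross m (A : 'M[C]_m) u v : hermitianmx A ->
  qform A (u + v) = qform A u + 2 * Re (dotc u (A *m v)) + qform A v.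
Proof.
move=> hA; rewrite /qform mulmxDr dotcDl !dotcDr !ReD.
have -> : Re (dotc v (A *m u)) = Re (dotc u (A *m v)).
  by rewrite -[RHS]Re_conj dotc_conj dotc_adj hA.
by move: (Re _) (Re _) (Re _) => x y z; ring.
Qed.

(** * Eigenvalues of Hermitian matrices *)

Lemma herm_spectral m (A : 'M[C]_m) : hermitianmx A ->
  exists (U : 'M[C]_m) (D : 'I_m -> R),
   [/\ adjmx U *m U = 1%:M, U *m adjmx U = 1%:M &
       A = adjmx U *m diag_mx (\row_i (D i)%:C) *m U].
Proof.
move=> hA; have Ah : A \is hermsymmx.
  by apply/is_hermitianmxP; rewrite expr0 scale1r -[LHS]hA.
have Dr := hermitian_spectral_diag_real Ah.
have Un := spectral_unitarymx A.
have /orthomx_spectralP := hermitian_normalmx Ah; rewrite invmx_unitary //.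
move: (spectralmx A) (spectral_diag A) Dr Un => P sp Dr Un e.
have e1 : P *m adjmx P = 1%:M by apply/unitarymxP.
exists P, (fun i => Re (sp 0 i)); split; [exact: mulmx1C | exact: e1 |].
rewrite e; congr (_ *m diag_mx _ *m _).
apply/rowP => i; rewrite mxE RRe_real //.
by have /mxOverP := Dr; exact.
Qed.

Lemma char_poly_conj m (U V D : 'M[C]_m) :
  V *m U = 1%:M -> char_poly (V *m D *m U) = char_poly D.
Proof.
move=> VU; rewrite /char_poly.
have -> : char_poly_mx (V *m D *m U) =
    map_mx polyC V *m char_poly_mx D *m map_mx polyC U.
  rewrite /char_poly_mx mulmxBr mulmxBl !map_mxM; congr (_ - _).
  by rewrite mul_mx_scalar -scalemxAl -map_mxM VU map_mx1 scalemx1.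
rewrite !det_mulmx mulrAC -det_mulmx -map_mxM VU map_mx1.
by rewrite det1 mul1r.
Qed.

(** The supremum defining lambda_max is an entry of a diagonal form, and the
same diagonal form gives the multiplicities of the eigenvalues. *)
Lemma lambda_max_spec m (A : 'M[C]_m) : (0 < m)%N -> hermitianmx A ->
  exists (U : 'M[C]_m) (D : 'I_m -> R) (k : 'I_m),
   [/\ adjmx U *m U = 1%:M, U *m adjmx U = 1%:M,
       A = adjmx U *m diag_mx (\row_i (D i)%:C) *m U &
       [/\ (forall i, D i <= D k), lambda_max A = D k &
       char_poly A = \prod_i ('X - (D i)%:C%:P)]].
Proof.
move=> m0 /herm_spectral [U [D [UU UU' AE]]].
have /= k0 : 'I_m := Ordinal m0.
pose k := [arg max_(i > k0) D i]%O.
have kmax i : D i <= D k.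
  by rewrite /k; case: arg_maxP => // j _; exact.
have cp : char_poly A = \prod_i ('X - (D i)%:C%:P).
  rewrite AE char_poly_conj // char_poly_trig ?diag_mx_is_trig//.
  by apply: eq_bigr => i _; rewrite !mxE eqxx.
exists U, D, k; split => //; split => //.
have ev x : eigenvalue A x%:C -> x <= D k.
  rewrite eigenvalue_root_char cp rootE horner_prod prodf_seq_eq0 => /hasP [i _ /=].
  by rewrite -rootE root_XsubC => /eqP /complexI ->.
have evk : eigenvalue A (D k)%:C.
  rewrite eigenvalue_root_char cp rootE horner_prod prodf_seq_eq0; apply/hasP; exists k => /=.
    by rewrite mem_index_enum.
  by rewrite -rootE root_XsubC.
apply/eqP; rewrite eq_le; apply/andP; split.
  by apply: ge_sup => //; exists (D k).
by apply: ub_le_sup => //; exists (D k).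
Qed.

Lemma sqn_unitary m (U : 'M[C]_m) v : adjmx U *m U = 1%:M -> sqn (U *m v) = sqn v.
Proof. by move=> h; rewrite /sqn dotc_adj mulmxA h mul1mx. Qed.

Lemma qform_diag m (U : 'M[C]_m) (D : 'I_m -> R) v :
  qform (adjmx U *m diag_mx (\row_i (D i)%:C) *m U) v =
  \sum_i D i * normc ((U *m v) i 0) ^+ 2.
Proof.
rewrite /qform -!mulmxA dotc_adj adjmxK; move: (U *m v) => y.
rewrite dotcE Re_sum; apply: eq_bigr => i _.
by rewrite mul_diag_mx !mxE mulrCA conj_mul_self ReZ.
Qed.

Lemma dotc_delta m (k : 'I_m) (v : 'cV[C]_m) : dotc (delta_mx k 0) v = v k 0.
Proof.
rewrite dotcE (bigD1 k) //= big1 => [|j /negPf jk]; rewrite !mxE ?eqxx ?jk /=.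
  by rewrite conjC1 mul1r addr0.
by rewrite conjC0 mul0r.
Qed.

Lemma sqn_delta m (k : 'I_m) : sqn (delta_mx k 0 : 'cV[C]_m) = 1.
Proof. by rewrite /sqn dotc_delta mxE !eqxx. Qed.

(** In an orthonormal eigenbasis the form is a sum of squares weighted by the
eigenvalues. *)
Lemma qform_le_lambda_max m (A : 'M[C]_m) v : (0 < m)%N -> hermitianmx A ->
  qform A v <= lambda_max A * sqn v.
Proof.
move=> m0 hA; have [U [D [k [UU _ -> [kmax -> _]]]]] := lambda_max_spec m0 hA.
rewrite qform_diag -(sqn_unitary v UU) sqnE mulr_sumr; apply: ler_sum => i _.
by rewrite ler_wpM2r ?sqr_ge0.
Qed.

Lemma lambda_max_eigen m (A : 'M[C]_m) : (0 < m)%N -> hermitianmx A ->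
  exists2 v, sqn v = 1 & A *m v = (lambda_max A)%:C *: v.
Proof.
move=> m0 hA; have [U [D [k [UU UU' AE [kmax -> _]]]]] := lambda_max_spec m0 hA.
exists (adjmx U *m delta_mx k 0); first by rewrite sqn_unitary ?adjmxK // sqn_delta.
rewrite AE -!mulmxA (mulmxA U) UU' mul1mx scalemxAr; congr (_ *m _).
apply/colP => i; rewrite mul_diag_mx !mxE eqxx andbT.
by have [->|] := eqVneq i k; rewrite ?mulr0.
Qed.

Lemma qform_eigen m (A : 'M[C]_m) a v : A *m v = a%:C *: v -> qform A v = a * sqn v.
Proof. by move=> e; rewrite /qform e dotcZr ReZ. Qed.

(** Orthogonally to the top eigenvector only the other eigenvalues occur, and
simplicity keeps these finitely many numbers away from the largest one. *)
Lemma simple_gap m (A : 'M[C]_m) : (0 < m)%N -> hermitianmx A ->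
  simple_eigenvalue A (lambda_max A)%:C ->
  exists w, exists2 delta : R, 0 < delta &
   [/\ sqn w = 1, A *m w = (lambda_max A)%:C *: w &
    forall z, dotc w z = 0 -> qform A z <= (lambda_max A - delta) * sqn z].
Proof.
move=> m0 hA; have [U [D [k [UU UU' AE [kmax lE cp]]]]] := lambda_max_spec m0 hA.
rewrite /simple_eigenvalue lE cp => sim.
have klt i : i != k -> D i < D k.
  move=> ik; rewrite lt_neqAle kmax andbT; apply/eqP => Dik.
  suff : (2 <= mup (D k)%:C (\prod_i ('X - (D i)%:C%:P)))%N by rewrite sim.
  rewrite mup_geq; last by apply/monic_neq0/monic_prod_XsubC.
  rewrite (bigD1 k) //= (bigD1 i) //= Dik mulrA -expr2.
  exact: dvdp_mulr.
have [delta d0 dP] : exists2 delta, 0 < delta & forall i, i != k -> D i <= D k - delta.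
  pose d := \big[Order.min/1]_(i | i != k) (D k - D i).
  exists d.
    rewrite /d; elim/big_ind : _ => // [x y x0 y0|i ik]; first by rewrite lt_min x0.
    by rewrite subr_gt0 klt.
  move=> i ik; rewrite lerBrDr -lerBrDl; exact: bigmin_le_cond.
exists (adjmx U *m delta_mx k 0), delta => //; split.
- by rewrite sqn_unitary ?adjmxK // sqn_delta.
- rewrite AE -!mulmxA (mulmxA U) UU' mul1mx scalemxAr; congr (_ *m _).
  apply/colP => i; rewrite mul_diag_mx !mxE eqxx andbT.
  by have [->|] := eqVneq i k; rewrite ?mulr0.
move=> z zk; rewrite AE qform_diag -(sqn_unitary z UU) sqnE mulr_sumr.
apply: ler_sum => i _.
have [->|ik] := eqVneq i k; last by rewrite ler_wpM2r ?sqr_ge0// dP.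
suff -> : (U *m z) k 0 = 0 by rewrite normc0 expr0n /= !mulr0.
by rewrite -zk -dotc_delta dotc_adj.
Qed.

Lemma lambda_max_le m (A : 'M[C]_m) (c : R) : (0 < m)%N -> hermitianmx A ->
  (forall v, qform A v <= c * sqn v) -> lambda_max A <= c.
Proof.
move=> m0 hA h; have [v v1 /qform_eigen Av] := lambda_max_eigen m0 hA.
by have := h v; rewrite Av v1 !mulr1.
Qed.

Lemma herm_adjM m n (A : 'M[C]_(m, n)) : hermitianmx (adjmx A *m A).
Proof. by rewrite /hermitianmx adjmxM adjmxK. Qed.

Lemma qform_adjM m n (A : 'M[C]_(m, n)) v : qform (adjmx A *m A) v = sqn (A *m v).
Proof. by rewrite /qform /sqn -mulmxA dotc_adj adjmxK. Qed.

Lemma spectral_norm_sq m n (A : 'M[C]_(m, n)) : (0 < n)%N ->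
  spectral_norm A ^+ 2 = lambda_max (adjmx A *m A).
Proof.
move=> n0; rewrite sqr_sqrtr //.
have [v v1 /qform_eigen] := lambda_max_eigen n0 (herm_adjM A).
by rewrite qform_adjM v1 mulr1 => <-; exact: sqn_ge0.
Qed.

Lemma spectral_norm_bound m n (A : 'M[C]_(m, n)) v : (0 < n)%N ->
  sqn (A *m v) <= spectral_norm A ^+ 2 * sqn v.
Proof.
move=> n0; rewrite spectral_norm_sq // -qform_adjM.
exact/qform_le_lambda_max/herm_adjM.
Qed.

Lemma spectral_norm_le m n (A : 'M[C]_(m, n)) c : (0 < n)%N ->
  (forall v, sqn (A *m v) <= c * sqn v) -> spectral_norm A ^+ 2 <= c.
Proof.
move=> n0 h; rewrite spectral_norm_sq //; apply: lambda_max_le => //.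
  exact: herm_adjM.
by move=> v; rewrite qform_adjM.
Qed.

(** By Cauchy-Schwarz, |A^H y|^2 = <A A^H y, y> <= |A| |A^H y| |y|; divide by
|A^H y|. *)
Lemma spectral_norm_adj_le m n (A : 'M[C]_(m, n)) : (0 < n)%N -> (0 < m)%N ->
  spectral_norm (adjmx A) ^+ 2 <= spectral_norm A ^+ 2.
Proof.
move=> n0 m0; apply: spectral_norm_le => // y.
have h1 := spectral_norm_bound A (adjmx A *m y) n0.
have := Cauchy_Schwarz_Re (A *m (adjmx A *m y)) y.
rewrite -[in X in X -> _](adjmxK A) -dotc_adj !adjmxK dotcc /=.
set a := sqn (adjmx A *m y) in h1 * => h2.
have [a0|a0] := eqVneq a 0; first by rewrite a0 mulr_ge0 ?sqr_ge0 ?sqn_ge0.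
have ap : 0 < a by rewrite lt_def a0 sqn_ge0.
rewrite -(ler_pM2l ap) -expr2; apply: le_trans h2 _.
by rewrite mulrCA mulrA ler_wpM2r ?sqn_ge0.
Qed.

Lemma spectral_norm_adj m n (A : 'M[C]_(m, n)) : (0 < n)%N -> (0 < m)%N ->
  spectral_norm (adjmx A) ^+ 2 = spectral_norm A ^+ 2.
Proof.
move=> n0 m0; apply/eqP; rewrite eq_le spectral_norm_adj_le //=.
by rewrite -{1}(adjmxK A) spectral_norm_adj_le.
Qed.

Lemma qform_bound m (A : 'M[C]_m) : (0 < m)%N ->
  exists2 h : R, 0 <= h & forall u v, Re (dotc u (A *m v)) ^+ 2 <= h ^+ 2 * (sqn u * sqn v).
Proof.
move=> m0; exists (spectral_norm A); first exact: sqrtr_ge0.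
move=> u v; apply: le_trans (Cauchy_Schwarz_Re _ _) _.
by rewrite mulrCA ler_wpM2l ?sqn_ge0 // spectral_norm_bound.
Qed.

End HermitianForms.

(** * Interpolation by matrices of minimal norm *)

Section Interpolation.
Variable R : realType.
Local Notation C := (R[i]).
Variable m : nat.
Implicit Types x u v y : 'cV[C]_m.

Definition outer u v : 'M[C]_m := u *m adjmx v.

Lemma outer_mul u v y : outer u v *m y = dotc v y *: u.
Proof.
rewrite /outer -mulmxA; apply/colP => i.
by rewrite !mxE big_ord1 mulrC.
Qed.

Lemma outer_adj u v : adjmx (outer u v) = outer v u.
Proof. by rewrite /outer adjmxM adjmxK. Qed.

Definition orth x u := u - (dotc x u / (sqn x)%:C) *: x.

Lemma orthE x u : u = (dotc x u / (sqn x)%:C) *: x + orth x u.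
Proof. by rewrite addrC subrK. Qed.

Lemma orthD x u v : orth x (u + v) = orth x u + orth x v.
Proof. by rewrite /orth dotcDr mulrDl scalerDl opprD addrACA. Qed.

Lemma orthZ a x u : orth x (a *: u) = a *: orth x u.
Proof. by rewrite /orth dotcZr -mulrA -scalerA -scalerBr. Qed.

Lemma orth_self x : x != 0 -> orth x x = 0.
Proof.
move=> x0; rewrite /orth dotcc mulfV ?scale1r ?subrr //.
by rewrite (inj_eq (@complexI R)) sqn_eq0.
Qed.

Lemma dotc_orth x u : x != 0 -> dotc x (orth x u) = 0.
Proof.
move=> x0; rewrite dotcBr dotcZr dotcc mulfVK ?subrr //.
by rewrite (inj_eq (@complexI R)) sqn_eq0.
Qed.

Lemma sqn_orth x u : x != 0 ->
  sqn u = normc (dotc x u) ^+ 2 / sqn x + sqn (orth x u).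
Proof.
move=> x0; have xn : (sqn x)%:C != 0 :> C.
  by rewrite (inj_eq (@complexI R)) sqn_eq0.
apply: (@complexI R); rewrite rmorphD /= rmorphM /= fmorphV -conj_mul_self -!dotcc.
rewrite /orth dotcBl !dotcBr !dotcZl !dotcZr -(dotc_conj x u) !dotcc.
by rewrite rmorphM fmorphV /= conj_real; field.
Qed.

Lemma eq_sqn_orth x u v : x != 0 ->
  normc (dotc x u) ^+ 2 = normc (dotc x v) ^+ 2 ->
  sqn (orth x u) = sqn (orth x v) -> sqn u = sqn v.
Proof. by move=> x0 e1 e2; rewrite (sqn_orth u x0) (sqn_orth v x0) e1 e2. Qed.

(** The Davis-Kahan-Weinberger dilation.  In orthonormal bases starting with the
direction of x, and up to the factor 1 / |x|, its nonzero block is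
[[a, |c|], [|b|, - conj a]], where a is the coefficient of u along the unit vector
x / |x|, and b and c are the components of u and v orthogonal to x.  When |b| = |c| the choice of
the last entry makes this block a multiple of a unitary matrix. *)
Definition interp x u v : 'M[C]_m :=
  (dotc x u / (sqn x)%:C ^+ 2) *: outer x x
  + (sqn x)%:C^-1 *: (outer (orth x u) x + outer x (orth x v))
  - (Num.conj (dotc x u) / ((sqn x)%:C * (sqn (orth x u))%:C))
      *: outer (orth x u) (orth x v).

Lemma interp_mul x u v y :
  interp x u v *m y =
  (dotc x u / (sqn x)%:C ^+ 2 * dotc x y + dotc (orth x v) y / (sqn x)%:C) *: x
  + (dotc x y / (sqn x)%:C
     - Num.conj (dotc x u) / ((sqn x)%:C * (sqn (orth x u))%:C)
       * dotc (orth x v) y) *: orth x u.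
Proof.
rewrite /interp mulmxBl !mulmxDl -!scalemxAl mulmxDl !outer_mul.
rewrite scalerDr !scalerA scalerBl scalerDl !addrA; congr (_ - _).
by rewrite addrAC [_^-1 * dotc x y]mulrC [_^-1 * _]mulrC.
Qed.

Lemma interp_dom x u v : x != 0 -> interp x u v *m x = u.
Proof.
move=> x0; have xn : (sqn x)%:C != 0 :> C.
  by rewrite (inj_eq (@complexI R)) sqn_eq0.
rewrite interp_mul -(dotc_conj x (orth x v)) dotc_orth // conjC0 !mulr0 mul0r subr0 addr0.
rewrite dotcc mulfV // scale1r.
by rewrite [_ / _ * _](_ : _ = dotc x u / (sqn x)%:C) -?orthE //; field.
Qed.

(** Exchanging u and v takes adjoints, so one formula produces both members of a
pair Delta_q, Delta_(sigma q), and a Hermitian matrix when u = v. *)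
Lemma interp_adj x u v : dotc x v = Num.conj (dotc x u) ->
  sqn (orth x u) = sqn (orth x v) -> adjmx (interp x u v) = interp x v u.
Proof.
move=> h hb; rewrite /interp adjmxB adjmxD !adjmxZ adjmxD !outer_adj hb h conjCK.
rewrite !fmorph_div fmorphV rmorphXn rmorphM /= conjCK !conj_real.
by rewrite [outer x _ + _]addrC.
Qed.

(** The squared norm of the image is |u|^2 / |x|^2 times the squared norm of the
projection of y onto the span of x and of the orthogonal part of v; Bessel's
inequality concludes. *)
Lemma interp_bound x u v y : x != 0 -> dotc x v = Num.conj (dotc x u) ->
  sqn (orth x u) = sqn (orth x v) ->
  sqn (interp x u v *m y) <= sqn u / sqn x * sqn y.
Proof.
move=> x0 h hb; have xn : (sqn x)%:C != 0 :> C.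
  by rewrite (inj_eq (@complexI R)) sqn_eq0.
pose p := dotc x y; pose q := dotc (orth x v) y; pose s := sqn (orth x u).
have xp : 0 < sqn x by rewrite sqn_gt0.
have bess : normc p ^+ 2 / sqn x + normc q ^+ 2 / s <= sqn y.
  rewrite -subr_ge0; move: (dotc_orth v x0) (dotcc (orth x v)); rewrite -hb -/s.
  rewrite /q; clearbody s; move: (orth x v) => c xc cc.
  have := sqn_ge0 (y - (p / (sqn x)%:C) *: x - (dotc c y / s%:C) *: c).
  congr (_ <= _); apply: (@complexI R).
  rewrite !(rmorphB, rmorphD) /= !fmorph_div /= -!conj_mul_self -!dotcc.
  rewrite !dotcBl !dotcBr !dotcZl !dotcZr -(dotc_conj x c) -(dotc_conj x y).
  rewrite -(dotc_conj c y) xc cc conjC0 !mulr0 !subr0 !dotcc -/p.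
  rewrite !fmorph_div /= !conj_real.
  have [s0|s0] := eqVneq s 0.
    by rewrite s0 rmorph0 invr0; field.
  have sn : s%:C != 0 :> C by rewrite (inj_eq (@complexI R)).
  by field; apply/andP.
suff -> : sqn (interp x u v *m y) =
    sqn u / sqn x * (normc p ^+ 2 / sqn x + normc q ^+ 2 / s).
  by rewrite ler_wpM2l // divr_ge0 ?sqn_ge0.
(* If u is a multiple of x, the last coefficient of interp is a division by
   zero, but the outer product that it multiplies vanishes. *)
have [s0|s0] := eqVneq s 0.
  have b0 : orth x u = 0 by apply/eqP; rewrite -sqn_eq0 -/s s0.
  have c0 : orth x v = 0 by apply/eqP; rewrite -sqn_eq0 -hb -/s s0.
  rewrite interp_mul (sqn_orth u x0) /q b0 c0 scaler0 dot0c !mul0r !addr0 sqnZ.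
  rewrite /sqn !dot0c addr0 normc0 expr0n /= mul0r addr0 -/(sqn x) -/p.
  rewrite -rmorphXn !normcM normcV !exprMn exprVn normc_real_sq.
  by field; rewrite gt_eqF.
have sn : s%:C != 0 :> C by rewrite (inj_eq (@complexI R)).
apply: (@complexI R); rewrite (sqn_orth u x0) rmorphM fmorph_div.
rewrite !rmorphD /= !fmorph_div /= -!conj_mul_self.
rewrite interp_mul -!dotcc -/q.
move: (dotc_orth u x0) (dotcc (orth x u)); rewrite -/s; move: (orth x u) => b xb bb.
rewrite dotcDl !dotcDr !dotcZl !dotcZr -(dotc_conj x b) xb conjC0 !mulr0 add0r addr0.
rewrite bb !dotcc -/p.
rewrite !(rmorphD, rmorphN, rmorphM, fmorphV) /= !conj_real ?conjCK.
by field; apply/andP.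
Qed.

End Interpolation.

(** * Minimizing the largest eigenvalue over an affine family *)

Section Pencil.
Variable R : realType.
Local Notation C := (R[i]).
Variables (m r : nat).
Hypothesis m_gt0 : (0 < m)%N.

Lemma lipschitz_rV_continuous (f : 'rV[R]_r -> R) (K : R) :
  (forall s t, f s <= f t + K * `|s - t|) -> continuous f.
Proof.
move=> h; suff fcont (t : 'rV[R]_r) : f x @[x --> t] --> f t by exact: fcont.
have K0 : 0 < `|K| + 1 by rewrite ltr_wpDl.
apply/(@cvgrPdist_lt _ _ _ (nbhs t) (nbhs_filter (t : 'rV[R]_r))) => e e0.
apply: (iffRL (@nbhs_normP R 'rV[R]_r t _)).
exists (e / (`|K| + 1)); first by rewrite /= divr_gt0.
move=> s /= st; have [h1 h2] := (h s t, h t s).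
have ? : K * `|t - s| < e.
  have : (`|K| + 1) * `|t - s| < e by rewrite mulrC -ltr_pdivlMr.
  have : K * `|t - s| <= `|K| * `|t - s| by rewrite ler_wpM2r ?ler_norm.
  by have := normr_ge0 (t - s); lra.
rewrite distrC in h1; rewrite ltr_distl; apply/andP; split; lra.
Qed.

Lemma entry_le_norm (t : 'rV[R]_r) i : `|t 0 i| <= `|t|.
Proof.
rewrite [leRHS]/Num.norm /= mx_normrE; apply/bigmax_geP; right => /=.
by exists (0, i).
Qed.

Definition pencil (J : 'M[C]_m) (H : 'I_r -> 'M[C]_m) (t : 'I_r -> R) :=
  J + \sum_i (t i)%:C *: H i.

Lemma pencil_herm J H t : hermitianmx J -> (forall i, hermitianmx (H i)) ->
  hermitianmx (pencil J H t).
Proof.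
move=> hJ hH; rewrite /hermitianmx adjmxD hJ adjmx_sum; congr (_ + _).
by apply: eq_bigr => i _; rewrite adjmxZ conj_real hH.
Qed.

Lemma qform_pencil J H t v :
  qform (pencil J H t) v = qform J v + \sum_i t i * qform (H i) v.
Proof.
by rewrite qformD qform_sum; congr (_ + _); apply: eq_bigr => i _; rewrite qformZ.
Qed.

Variables (J : 'M[C]_m) (H : 'I_r -> 'M[C]_m).
Hypothesis hJ : hermitianmx J.
Hypothesis hH : forall i, hermitianmx (H i).

(** Evaluate both quadratic forms at a top eigenvector of the first matrix. *)
Lemma lambda_max_pencil_lip (s t : 'rV[R]_r) :
  lambda_max (pencil J H (fun i => s 0 i)) <=
  lambda_max (pencil J H (fun i => t 0 i)) +
  (\sum_i spectral_norm (H i)) * `|s - t|.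
Proof.
have hs := pencil_herm (fun i => s 0 i) hJ hH.
have [v v1 /qform_eigen] := lambda_max_eigen m_gt0 hs.
rewrite v1 mulr1 => <-.
have := qform_le_lambda_max v m_gt0 (pencil_herm (fun i => t 0 i) hJ hH).
rewrite v1 mulr1 !qform_pencil => h.
rewrite -lerBlDl; apply: le_trans (lerB (lexx _) h) _.
rewrite opprD addrACA subrr add0r -sumrB mulr_suml; apply: ler_sum => i _.
rewrite -mulrBl mulrC; apply: le_trans (ler_norm _) _; rewrite normrM.
apply: ler_pM => //; last first.
  by rewrite (_ : s 0 i - t 0 i = (s - t) 0 i) ?entry_le_norm // !mxE.
rewrite -(ler_pXn2r (_ : 0 < 2)%N) ?nnegrE ?sqrtr_ge0 // real_normK ?num_real //.
apply: le_trans (Cauchy_Schwarz_Re _ _) _; rewrite v1 mul1r -[leRHS]mulr1 -v1.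
exact: spectral_norm_bound.
Qed.

End Pencil.

(** The largest eigenvalue g of sum_i t_i H_i is positive on the compact set of
unit vectors of T, hence is at least c |t| on T by homogeneity; as J is
positive semidefinite, the same bound holds with J added, and the minimum may
be sought in a ball.  The set T leaves room for directions along which the
largest eigenvalue is constant. *)
Lemma lambda_max_pencil_min (R : realType) m r (J : 'M[R[i]]_m)
   (H : 'I_r -> 'M[R[i]]_m) (T : set 'rV[R]_r) :
  (0 < m)%N -> hermitianmx J -> (forall i, hermitianmx (H i)) ->
  (forall v, 0 <= qform J v) ->
  T 0 -> closed T -> (forall a t, T t -> T (a *: t)) ->
  (forall t, T t -> t != 0 -> exists v, 0 < \sum_i t 0 i * qform (H i) v) ->
  exists2 t, T t & forall s, T s ->
    lambda_max (pencil J H (fun i => t 0 i)) <= lambda_max (pencil J H (fun i => s 0 i)).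
Proof.
move=> m0 hJ hH J0 T0 Tc Tz Tpos.
have h0 : hermitianmx (0 : 'M[R[i]]_m).
  by apply/matrixP => i j; rewrite adjmxE !mxE rmorph0.
pose f (t : 'rV[R]_r) := lambda_max (pencil J H (fun i => t 0 i)).
pose g (t : 'rV[R]_r) := lambda_max (pencil 0 H (fun i => t 0 i)).
have fc : continuous f by apply: lipschitz_rV_continuous => s t; exact: lambda_max_pencil_lip.
have gc : continuous g by apply: lipschitz_rV_continuous => s t; exact: lambda_max_pencil_lip.
have nc : continuous (fun t : 'rV[R]_r => `|t|).
  by apply: (@lipschitz_rV_continuous _ _ _ 1) => s t; rewrite mul1r addrC -lerBlDr lerB_dist.
have closed_le c : closed [set t : 'rV[R]_r | `|t| <= c].
  apply: (@closed_comp _ _ (fun t : 'rV[R]_r => `|t|) [set x | x <= c]).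
    by move=> t _; exact: nc.
  exact: closed_le.
suff fP : exists2 t, T t & forall s, T s -> f t <= f s by exact: fP.
have [c c0 cP] : exists2 c, 0 < c & forall t, T t -> c * `|t| <= f t.
  have gf t : g t <= f t.
    apply: lambda_max_le => //; first exact: (pencil_herm _ h0 hH).
    move=> v; apply: le_trans (qform_le_lambda_max v m0 (pencil_herm _ hJ hH)).
    rewrite !qform_pencil lerD2r [leLHS]/qform mul0mx dotc0; exact: J0.
  have gZ a t : 0 < a -> a * g t <= g (a *: t).
    move=> a0; have [v v1 /qform_eigen] := lambda_max_eigen m0 (pencil_herm (fun i => t 0 i) h0 hH).
    rewrite v1 mulr1 -/(g t) => <-.
    have := qform_le_lambda_max v m0 (pencil_herm (fun i => (a *: t) 0 i) h0 hH).
    rewrite v1 mulr1; apply: le_trans; rewrite !qform_pencil mulrDr lerD //.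
      by rewrite /qform mul0mx dotc0 mulr0.
    by rewrite mulr_sumr ler_sum // => i _; rewrite mxE mulrA.
  have g0 t : T t -> t != 0 -> 0 < g t.
    move=> Tt t0; have [v vP] := Tpos t Tt t0.
    have := qform_le_lambda_max v m0 (pencil_herm (fun i => t 0 i) h0 hH).
    rewrite -/(g t) qform_pencil {1}/qform mul0mx dotc0 add0r => h.
    have := lt_le_trans vP h; rewrite pmulr_lgt0 // sqn_gt0; apply/eqP => v0.
    by move: (lt_le_trans vP h); rewrite v0 /sqn dotc0 mulr0 ltxx.
  have g00 : 0 <= g 0.
    have [v v1 /qform_eigen] :=
      lambda_max_eigen m0 (pencil_herm (fun i => (0 : 'rV[R]_r) 0 i) h0 hH).
    rewrite v1 mulr1 -/(g 0) => <-; rewrite qform_pencil /qform mul0mx dotc0 add0r.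
    by rewrite sumr_ge0 // => i _; rewrite mxE mul0r.
  clearbody f g; pose S := T `&` [set t : 'rV[R]_r | `|t| = 1].
  have [S0|] := pselect (S !=set0); last first.
    move=> S0; exists 1; first exact: ltr01.
    move=> t Tt; have [->|t0] := eqVneq t 0.
      by rewrite normr0 mulr0; apply: le_trans (gf 0).
    case: S0; exists (`|t|^-1 *: t); split; first exact: Tz.
    by rewrite /= normrZ normfV normr_id mulVf ?normr_eq0.
  have Scomp : compact S.
    apply: bounded_closed_compact.
      exists 1; split; first exact: num_real.
      by move=> x x1 t [_ /= ->]; exact: ltW.
    apply: closedI => //.
    apply: (@closed_comp _ _ (fun t : 'rV[R]_r => `|t|) [set x | x = 1]).
      by move=> t _; exact: nc.
    exact: closed_eq.
  have [t0 t0S t0P] := EVT_min_rV S0 Scomp (continuous_subspaceT gc).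
  move: t0S; rewrite inE => -[Tt0 t01].
  have t0n : t0 != 0 by rewrite -normr_eq0 t01 oner_eq0.
  exists (g t0); first exact: g0.
  move=> t Tt; have [->|tn] := eqVneq t 0.
    by rewrite normr0 mulr0; apply: le_trans (gf 0).
  apply: le_trans (gf t).
  have tp : 0 < `|t| by rewrite normr_gt0.
  have -> : g t = g (`|t| *: (`|t|^-1 *: t)).
    by congr g; rewrite scalerA mulfV ?scale1r // gt_eqF.
  apply: le_trans (gZ _ _ tp); rewrite mulrC.
  have tS : (`|t|^-1 *: t) \in S.
    rewrite inE; split; first exact: Tz.
    by rewrite /= normrZ normfV normr_id mulVf // gt_eqF.
  by have := t0P _ tS; move: (g t0) (g _) => x y xy; rewrite ler_pM2l.
clearbody f g; pose B := T `&` [set t : 'rV[R]_r | `|t| <= f 0 / c].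
have f0 : 0 <= f 0 by have := cP 0 T0; rewrite normr0 mulr0.
have B0 : B 0 by split => //=; rewrite normr0 divr_ge0 // ltW.
have Bcomp : compact B.
  apply: bounded_closed_compact; last exact: closedI.
  exists (f 0 / c); split; first exact: num_real.
  by move=> x x1 t [_ /= h]; apply: le_trans h (ltW x1).
have [t tB tP] := EVT_min_rV (ex_intro _ 0 B0) Bcomp (continuous_subspaceT fc).
move: tB; rewrite inE => -[Tt _]; exists t; first exact: Tt.
move=> s Ts.
have [sB|sB] := leP `|s| (f 0 / c); first by apply: tP; rewrite inE.
apply: (le_trans (tP 0 _)); first by rewrite inE.
apply: le_trans (cP s Ts); move: sB; rewrite ltr_pdivrMr // mulrC.
exact: ltW.
Qed.

(** * Stationarity at a simple largest eigenvalue *)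

Section Stationary.
Variable R : realType.
Local Notation C := (R[i]).

(** A small step along H lowers the largest eigenvalue.  Split a unit top
eigenvector of A + s H as al w + r with r orthogonal to w: the spectral gap
costs delta |r|^2, the direction w costs s |<w, H w>| |al|^2, and the cross
term is absorbed by the arithmetic-geometric mean inequality. *)
Lemma lambda_max_decreases m (A H : 'M[C]_m) w delta : (0 < m)%N ->
  hermitianmx A -> hermitianmx H -> 0 < delta ->
  sqn w = 1 -> A *m w = (lambda_max A)%:C *: w ->
  (forall z, dotc w z = 0 -> qform A z <= (lambda_max A - delta) * sqn z) ->
  qform H w < 0 -> exists s : R, lambda_max (A + s%:C *: H) < lambda_max A.
Proof.
move=> m0 hA hH d0 w1 Aw gap c0.
have [h h0 hP] := qform_bound H m0.
set c := - qform H w; have cp : 0 < c by rewrite /c oppr_gt0.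
(* The cross term is at most (c / 2) |al|^2 + (2 h^2 / c) |r|^2, so r is
   charged s (h + 2 h^2 / c); s makes this less than delta / 2. *)
pose K := h + 2 * h ^+ 2 / c + 1.
have Kp : 0 < K.
  by rewrite /K ltr_wpDl // addr_ge0 // divr_ge0 ?(ltW cp) // mulr_ge0 // sqr_ge0.
pose s := delta / (2 * K).
have sp : 0 < s by rewrite divr_gt0 // mulr_gt0.
exists s; rewrite ltNge; apply/negP => hle.
have hAs : hermitianmx (A + s%:C *: H).
  by rewrite /hermitianmx adjmxD adjmxZ conj_real hA hH.
have [z z1 /qform_eigen] := lambda_max_eigen m0 hAs.
rewrite z1 mulr1 qformD qformZ => zE.
pose al := dotc w z; pose r := orth w z.
have wn : w != 0 by rewrite -sqn_gt0 w1.
have wr : dotc w r = 0 by exact: dotc_orth.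
have zr : z = al *: w + r by rewrite {1}(orthE w z) w1 divr1.
have ar1 : normc al ^+ 2 + sqn r = 1 by rewrite -z1 (sqn_orth z wn) w1 divr1.
clearbody al r.
have qA : qform A z <= lambda_max A - delta * sqn r.
  rewrite zr qform_add_cross // qform_scale (qform_eigen Aw) w1 mulr1.
  have -> : Re (dotc (al *: w) (A *m r)) = 0.
    by rewrite dotc_adj hA -scalemxAr Aw !dotcZl wr !mulr0.
  have -> : normc al ^+ 2 = 1 - sqn r by rewrite -ar1 addrK.
  have := gap _ wr; move: (qform A r) (sqn r) (lambda_max A) => q rho l hq.
  apply: le_trans (lerD (lexx _) hq) _; rewrite le_eqVlt; apply/orP; left; apply/eqP.
  by ring.
have qH : qform H z <= - c * normc al ^+ 2 +
    (c / 2 * normc al ^+ 2 + 2 * h ^+ 2 / c * sqn r) + h * sqn r.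
  rewrite zr qform_add_cross // qform_scale; apply: lerD; first apply: lerD.
  - by rewrite /c opprK mulrC.
  - apply: le_of_sqr.
      rewrite addr_ge0 // mulr_ge0 ?sqr_ge0 ?sqn_ge0 // divr_ge0 ?(ltW cp) //.
      by rewrite mulr_ge0 // sqr_ge0.
    have := hP (al *: w) r; rewrite sqnZ w1 mulr1.
    move: (Re _) (normc al ^+ 2) (sqn r) => X a rho hX.
    rewrite exprMn; apply: (@le_trans _ _ (4 * (h ^+ 2 * (a * rho)))).
      by rewrite -natrX ler_pM2l.
    rewrite -subr_ge0 [leRHS](_ : _ = (c / 2 * a - 2 * h ^+ 2 / c * rho) ^+ 2) ?sqr_ge0 //.
    by field; rewrite gt_eqF.
  - apply: le_of_sqr; first by rewrite mulr_ge0 ?sqn_ge0.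
    by rewrite exprMn [X in _ * X]expr2; exact: hP.
have key : s * K = delta / 2 by rewrite /s; field; rewrite gt_eqF.
have rho0 := sqn_ge0 r; have a0 : 0 <= normc al ^+ 2 by exact: sqr_ge0.
move: hle; rewrite -zE => hle.
have hs : s * qform H z <= - (s * (c / 2)) * normc al ^+ 2 + (s * K) * sqn r - s * sqn r.
  apply: le_trans (ler_wpM2l (ltW sp) qH) _; rewrite /K le_eqVlt; apply/orP; left; apply/eqP.
  by field; rewrite gt_eqF.
have scp : 0 < s * (c / 2) by rewrite mulr_gt0 // divr_gt0.
rewrite key in hs.
move: scp hs hle; move: (mulr_ge0 (ltW sp) rho0).
move: (s * (c / 2)) (s * qform H z) (s * sqn r) => e X Y Y0 e0 hs hle.
move: (normc al ^+ 2) (sqn r) ar1 rho0 a0 qA hs Y0 => a rho ar rho0 a0 qA hs Y0.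
have p1 : 0 <= e * a by rewrite mulr_ge0 // ltW.
have p2 : 0 <= delta * rho by rewrite mulr_ge0 // ltW.
have [/eqP ea0 /eqP dr0] : e * a = 0 /\ delta * rho = 0.
  move: hle qA hs Y0 p1 p2; rewrite mulNr [delta / 2 * rho]mulrAC.
  move: (qform A z) (lambda_max A) (delta * rho) (e * a) => q l dr ea.
  by clear; split; lra.
move: ea0 dr0.
rewrite !mulf_eq0 (gt_eqF e0) (gt_eqF d0) /= => /eqP a0' /eqP r0.
by move: ar; rewrite r0 a0' addr0 => /eqP; rewrite eq_sym oner_eq0.
Qed.

(** A negative value of the form of H, or of that of - H, would let a small step
lower the largest eigenvalue. *)
Lemma simple_top_stationary m (A : 'M[C]_m) : (0 < m)%N ->
  hermitianmx A -> simple_eigenvalue A (lambda_max A)%:C ->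
  exists w, [/\ sqn w = 1, A *m w = (lambda_max A)%:C *: w &
    forall H, hermitianmx H ->
      (forall s : R, lambda_max A <= lambda_max (A + s%:C *: H)) -> qform H w = 0].
Proof.
move=> m0 hA /(simple_gap m0 hA) [w [delta d0 [w1 Aw gap]]].
exists w; split => // H hH hmin; apply/eqP; rewrite eq_le !leNgt.
have hHN : hermitianmx (- H) by rewrite /hermitianmx adjmxN hH.
apply/andP; split; apply/negP => hq.
  have [|s] := lambda_max_decreases m0 hA hHN d0 w1 Aw gap.
    by rewrite /qform mulNmx dotcNr ReN oppr_lt0.
  by rewrite scalerN -scaleNr -rmorphN ltNge hmin.
have [s] := lambda_max_decreases m0 hA hH d0 w1 Aw gap hq.
by rewrite ltNge hmin.
Qed.

End Stationary.

(** * Block vectors *)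

Section Blocks.
Variable R : realType.
Local Notation C := (R[i]).
Variables (N n : nat).
Implicit Types (v w : 'cV[C]_(N * n)) (q : 'I_N).

Definition block v q : 'cV[C]_n := \col_i v (mxtens_index (q, i)) 0.
Definition unblock (F : 'I_N -> 'cV[C]_n) : 'cV[C]_(N * n) :=
  \col_s F (mxtens_unindex s).1 (mxtens_unindex s).2 0.

Lemma unblockK F q : block (unblock F) q = F q.
Proof. by apply/colP => i; rewrite !mxE mxtens_indexK. Qed.

Lemma blockD v w q : block (v + w) q = block v q + block w q.
Proof. by apply/colP => i; rewrite !mxE. Qed.
Lemma blockN v q : block (- v) q = - block v q.
Proof. by apply/colP => i; rewrite !mxE. Qed.
Lemma blockZ a v q : block (a *: v) q = a *: block v q.
Proof. by apply/colP => i; rewrite !mxE. Qed.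

Lemma sum_mxtens (V : nmodType) (F : 'I_(N * n) -> V) :
  \sum_s F s = \sum_q \sum_i F (mxtens_index (q, i)).
Proof.
rewrite pair_bigA /= (reindex (@mxtens_index N n)) /=.
  by apply: eq_bigr => -[].
exists (@mxtens_unindex N n) => s _; [exact: mxtens_indexK | exact: mxtens_unindexK].
Qed.

Lemma dotc_block v w : dotc v w = \sum_q dotc (block v q) (block w q).
Proof.
rewrite dotcE sum_mxtens; apply: eq_bigr => q _.
by rewrite dotcE; apply: eq_bigr => i _; rewrite !mxE.
Qed.

Lemma sqn_block v : sqn v = \sum_q sqn (block v q).
Proof. by rewrite /sqn dotc_block Re_sum. Qed.

Lemma block_tens (A : 'M[C]_N) (B : 'M[C]_n) v q :
  block ((A *t B) *m v) q = \sum_r A q r *: (B *m block v r).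
Proof.
apply/colP => i; rewrite !mxE sum_mxtens summxE; apply: eq_bigr => r _.
rewrite !mxE mulr_sumr; apply: eq_bigr => j _.
by rewrite tensmxE !mxE mulrA.
Qed.

Lemma adjmx_tens (A : 'M[C]_N) (B : 'M[C]_n) : adjmx (A *t B) = adjmx A *t adjmx B.
Proof. by rewrite /adjmx trmx_tens map_mxT. Qed.

End Blocks.

(** * The matrices of the palindromic problem *)

Section Palindromic.
Variable R : realType.
Local Notation C := (R[i]).
Variables n d k : nat.
Local Notation N := (d.+1 + k)%N.
Variables (G : rmp R n d k) (lam : C).
Local Notation M := (invmx (rmp_eval G lam)).
Local Notation L := (Lam G lam).
Local Notation Gm := (Gam n d k lam).
Local Notation Cg := (Cgen G lam).

Lemma split_lshift p : fintype.split (lshift k p : 'I_N) = inl p.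
Proof. exact: (unsplitK (inl p)). Qed.
Lemma split_rshift j : fintype.split (rshift d.+1 j : 'I_N) = inr j.
Proof. exact: (unsplitK (inr j)). Qed.

(** The involution sigma: Delta_(sigma q) is to be the adjoint of Delta_q. *)
Definition dual_idx (q : 'I_N) : 'I_N :=
  match fintype.split q with inl p => lshift k (rev_ord p) | inr _ => q end.

Lemma dual_idx_l p : dual_idx (lshift k p) = lshift k (rev_ord p).
Proof. by rewrite /dual_idx split_lshift. Qed.
Lemma dual_idx_r j : dual_idx (rshift d.+1 j) = rshift d.+1 j.
Proof. by rewrite /dual_idx split_rshift. Qed.
Lemma dual_idxK : involutive dual_idx.
Proof.
move=> q; case: (split_ordP q) => [p ->|j ->]; last by rewrite !dual_idx_r.
by rewrite !dual_idx_l rev_ordK.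
Qed.

(** The scalar c_q for which H_q is, up to the congruence by the inverse of
Gamma, the Hermitian matrix c_q C + (c_q C)^H with C = C(q, sigma q).  The
factor 1 / 2 occurs where q = sigma q, since iC is then already Hermitian. *)
Definition Hcoef (q : 'I_N) : C :=
  match fintype.split q with
  | inl p => if (2 * p < d)%N then 1 else if (2 * p == d)%N then 'i%C / 2 else 'i%C
  | inr _ => 'i%C / 2
  end.

Definition weight (q : 'I_N) : R :=
  match fintype.split q with inl p => gamma_entry lam p | inr _ => 1 end.

Lemma Lam_l p : L 0 (lshift k p) = lam ^+ p.
Proof. by rewrite /Lam row_mxEl mxE. Qed.
Lemma Lam_r j : L 0 (rshift d.+1 j) = rmp_w G j lam.
Proof. by rewrite /Lam row_mxEr mxE. Qed.

Definition lamsum (v : 'cV[C]_(N * n)) : 'cV[C]_n := \sum_q L 0 q *: block v q.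
(** When the blocks are v_q = Delta_q x and lam is an eigenvalue of the perturbed
polynomial with eigenvector x, this is x again. *)
Definition xvec v := M *m lamsum v.

Lemma block_Cgen a b v q :
  block (Cg a b *m v) q =
  Num.conj (L 0 q) *: (adjmx M *m block v a) - (q == b)%:R *: xvec v.
Proof.
rewrite /Cgen mulmxBl blockD blockN !block_tens; congr (_ - _).
  rewrite (bigD1 a) //= big1 => [|r /negPf ra]; rewrite !mxE big_ord1 !mxE ?eqxx ?ra /=.
    by rewrite conjC1 mulr1 addr0.
  by rewrite conjC0 mulr0 scale0r.
rewrite /xvec /lamsum mulmx_sumr scaler_sumr; apply: eq_bigr => r _.
by rewrite !mxE big_ord1 !mxE eqxx andbT -scalemxAr scalerA.
Qed.

Lemma dotc_lamsum v (u : 'cV[C]_n) :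
  \sum_q dotc (block v q) (Num.conj (L 0 q) *: u) = dotc (lamsum v) u.
Proof.
rewrite -[RHS](dotc_conj u) /lamsum dotc_sumr rmorph_sum; apply: eq_bigr => q _.
by rewrite dotcZr dotcZr rmorphM /= dotc_conj.
Qed.

Definition alpha v q := dotc (xvec v) (block v q).

Lemma dotc_Cgen a b v :
  dotc v (Cg a b *m v) = alpha v a - Num.conj (alpha v b).
Proof.
rewrite dotc_block; pose u := adjmx M *m block v a.
rewrite (eq_bigr (fun q => dotc (block v q) (Num.conj (L 0 q) *: u) -
   dotc (block v q) ((q == b)%:R *: xvec v))); last first.
  by move=> q _; rewrite block_Cgen dotcBr.
rewrite sumrB; congr (_ - _).
  by rewrite (dotc_lamsum v u) [LHS]dotc_adj adjmxK.
rewrite /alpha dotc_conj; move: (xvec v) => x.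
rewrite (bigD1 b) //= big1; first by rewrite eqxx scale1r addr0.
by move=> q /negPf qb; rewrite qb scale0r dotc0.
Qed.

Lemma adj_Cgen a b : adjmx (Cg a b) = - Cg b a.
Proof. by rewrite /Cgen adjmxB !adjmx_tens !adjmxM !adjmxK opprB. Qed.

Lemma block_Jtilde v q :
  block (Jtilde G lam *m v) q = Num.conj (L 0 q) *: (adjmx M *m xvec v).
Proof.
rewrite block_tens /xvec /lamsum !mulmx_sumr scaler_sumr; apply: eq_bigr => r _.
by rewrite mxE big_ord1 adjmxE -!scalemxAr scalerA mulmxA.
Qed.

Lemma qform_Jtilde v : qform (Jtilde G lam) v = sqn (xvec v).
Proof.
rewrite /qform dotc_block.
under eq_bigr do rewrite block_Jtilde.
by rewrite dotc_lamsum dotc_adj adjmxK.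
Qed.

Lemma herm_Jtilde : hermitianmx (Jtilde G lam).
Proof. by rewrite /hermitianmx /Jtilde adjmx_tens !adjmxM !adjmxK. Qed.

Lemma block_Gam v q : block (Gm *m v) q = (weight q)%:C *: block v q.
Proof.
rewrite block_tens (bigD1 q) //= big1 => [|r /negPf rq]; last first.
  by rewrite mxE eq_sym rq mulr0n scale0r.
rewrite addr0 mul1mx; congr (_ *: _); rewrite [LHS]mxE eqxx mulr1n /weight.
by rewrite mxE; case: fintype.split => j; rewrite mxE.
Qed.

Lemma herm_Gam : hermitianmx Gm.
Proof.
rewrite /hermitianmx adjmx_tens; congr (_ *t _); last first.
  by apply/matrixP => i j; rewrite adjmxE !mxE rmorph_nat eq_sym.
apply/matrixP => i j; rewrite adjmxE mxE [RHS]mxE eq_sym; have [->|] := eqVneq.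
  rewrite !mulr1n mxE; case: fintype.split => p; rewrite mxE ?rmorph1 //.
  exact: conj_real.
by rewrite !mulr0n rmorph0.
Qed.

Hypothesis lam0 : lam != 0.

(** To prove a statement that passes from q to sigma q, it is enough to treat the
polynomial indices below the middle and the fixed points of sigma. *)
Lemma dual_idx_ind (P : 'I_N -> Prop) :
  (forall p : 'I_d.+1, (2 * p < d)%N -> P (lshift k p)) ->
  (forall p : 'I_d.+1, (2 * p < d)%N -> P (lshift k p) -> P (lshift k (rev_ord p))) ->
  (forall q, dual_idx q = q -> weight q = 1 -> Hcoef q = 'i%C / 2 -> P q) -> forall q, P q.
Proof.
move=> h1 h2 h3 q; case: (split_ordP q) => [p ->|j ->].
  case: (ltngtP (2 * p) d) => hp; first exact: h1.
    rewrite -[p]rev_ordK; suff hr : (2 * rev_ord p < d)%N by apply: h2 => //; exact: h1.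
    have := ltn_ord p; rewrite /= ltnS => pd; rewrite subSS mulnBr ltn_subLR.
      by rewrite mul2n -addnn ltn_add2r.
    by rewrite leq_mul2l /=.
  apply: h3; first 1 last.
  - by rewrite /weight split_lshift /gamma_entry hp ltnn eqxx.
  - by rewrite /Hcoef split_lshift hp ltnn eqxx.
  rewrite dual_idx_l; congr lshift; apply: val_inj; rewrite /= subSS -{1}hp mul2n -addnn.
  by rewrite addnK.
by apply: h3; rewrite ?dual_idx_r // /weight /Hcoef split_rshift.
Qed.

Lemma rev_half (p : 'I_d.+1) : (2 * p < d)%N ->
  [/\ (2 * rev_ord p < d)%N = false, (2 * rev_ord p == d)%N = false &
      (d - rev_ord p)%N = p].
Proof.
move=> hp; have pd : (p <= d)%N by rewrite -ltnS.
rewrite /= subSS; split; last by rewrite subKn.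
  by apply/negbTE; rewrite -leqNgt; lia.
by apply/negbTE; rewrite neq_ltn; apply/orP; right; lia.
Qed.

Lemma weight_low (p : 'I_d.+1) : (2 * p < d)%N ->
  let rho := normc lam ^+ (d - 2 * p) in
  [/\ 0 < weight (lshift k p), 0 < weight (lshift k (rev_ord p)),
     weight (lshift k p) ^+ 2 = 2 / (1 + rho) &
     weight (lshift k (rev_ord p)) ^+ 2 = 2 * rho / (1 + rho)].
Proof.
move=> hp rho; have [r1 r2 r3] := rev_half hp.
have rho0 : 0 < rho by rewrite exprn_gt0 // normc_gt0.
rewrite /weight !split_lshift /gamma_entry hp r1 r2 r3 /gamma1 /gamma2 -/rho.
have h1 : 0 < 2 / (1 + rho) by rewrite divr_gt0 // addr_gt0.
have h2 : 0 < 2 * rho / (1 + rho) by rewrite divr_gt0 ?mulr_gt0 // addr_gt0.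
by rewrite !sqrtr_gt0 h1 h2 !sqr_sqrtr ?ltW.
Qed.

Lemma weight_gt0 q : 0 < weight q.
Proof.
move: q; apply: dual_idx_ind => [p hp|p hp _|q _ -> _] //; by have [] := weight_low hp.
Qed.

Lemma weight_sqD q : weight q ^+ 2 + weight (dual_idx q) ^+ 2 = 2.
Proof.
move: q; apply: dual_idx_ind => [p hp|p hp|q -> -> _]; last by rewrite expr1n.
  rewrite dual_idx_l; have [_ _ -> ->] := weight_low hp.
  by field; rewrite gt_eqF // addr_gt0 // exprn_gt0 // normc_gt0.
by rewrite !dual_idx_l rev_ordK addrC.
Qed.

(** This is what determines the weights among those with g_q^2 + g_(sigma q)^2 = 2. *)
Lemma weight_balance q :
  normc (L 0 q) * weight (dual_idx q) ^+ 2 =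
  normc (L 0 (dual_idx q)) * weight q ^+ 2.
Proof.
move: q; apply: dual_idx_ind => [p hp|p hp|q -> _ _] //; last first.
  by rewrite !dual_idx_l rev_ordK.
rewrite dual_idx_l !Lam_l; have [_ _ -> ->] := weight_low hp.
rewrite !normcX /= subSS [in RHS](_ : (d - p)%N = (p + (d - 2 * p))%N); last by lia.
rewrite exprD; ring.
Qed.

Lemma Gam_unit : (0 < n)%N -> Gm \in unitmx.
Proof.
move=> n0; apply: tensmx_unit => //; [by rewrite -lt0n | | exact: unitmx1].
rewrite unitmxE det_diag unitfE; apply/prodf_neq0 => q _.
have := weight_gt0 q; rewrite /weight mxE; case: fintype.split => p; rewrite mxE //.
by move=> /gt_eqF gp; rewrite (inj_eq (@complexI R)) gp.
Qed.

Definition Hcore q := Hcoef q *: Cg q (dual_idx q) - Num.conj (Hcoef q) *: Cg (dual_idx q) q.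

Lemma Hmx_E q : Hmx G lam q = invmx Gm *m Hcore q *m invmx Gm.
Proof.
case: (split_ordP q) => [p ->|j ->].
  rewrite /Hmx split_lshift /Hpoly /Hcore /Hcoef dual_idx_l split_lshift.
  case: ifP => hp.
    rewrite /Ctilde adj_Cgen; move: (Cg _ _) (Cg _ _) (invmx Gm) => A B V.
    by rewrite rmorph1 !scale1r.
  case: ifP => hp2.
    have -> : rev_ord p = p.
      by apply: val_inj => /=; move/eqP: hp2; have := ltn_ord p; lia.
    move: (Cg _ _) (invmx Gm) => A V.
    by rewrite conj_i_half scaleNr opprK -scalerDl -splitr.
  rewrite /Ctilde rev_ordK adj_Cgen.
  move: (Cg _ _) (Cg _ _) (invmx Gm) => A B V.
  by rewrite scalemxAl scalemxAr !opprK conj_i scaleNr opprK -scalerDr addrC.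
rewrite /Hmx split_rshift /Hrat /Hcore /Hcoef dual_idx_r split_rshift.
move: (Cg _ _) (invmx Gm) => A V.
by rewrite conj_i_half scaleNr opprK -scalerDl -splitr.
Qed.

Lemma herm_Hcore q : hermitianmx (Hcore q).
Proof. by apply: herm_skew; exact: adj_Cgen. Qed.

Hypothesis n_gt0 : (0 < n)%N.
Let Nn_gt0 : (0 < N * n)%N. Proof. by rewrite muln_gt0. Qed.

Lemma herm_conjGam (A : 'M[C]_(N * n)) : hermitianmx A ->
  hermitianmx (invmx Gm *m A *m invmx Gm).
Proof.
by move=> hA; rewrite /hermitianmx !adjmxM hA (invmx_herm (Gam_unit n_gt0) herm_Gam) mulmxA.
Qed.

Lemma qform_conjGam (A : 'M[C]_(N * n)) v :
  qform (invmx Gm *m A *m invmx Gm) (Gm *m v) = qform A v.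
Proof.
rewrite /qform -!mulmxA mulKmx ?Gam_unit // dotc_adj.
by rewrite (invmx_herm (Gam_unit n_gt0) herm_Gam) mulKmx ?Gam_unit.
Qed.

Lemma herm_J : hermitianmx (Jmx G lam).
Proof. exact/herm_conjGam/herm_Jtilde. Qed.
Lemma herm_H q : hermitianmx (Hmx G lam q).
Proof. by rewrite Hmx_E; apply/herm_conjGam/herm_Hcore. Qed.
Lemma herm_JH t : hermitianmx (JH G lam t).
Proof. exact: (pencil_herm t herm_J herm_H). Qed.

Lemma qform_H v q :
  qform (Hmx G lam q) (Gm *m v) =
  2 * Re (Hcoef q * (alpha v q - Num.conj (alpha v (dual_idx q)))).
Proof.
by rewrite Hmx_E qform_conjGam; apply: qform_skew; exact: dotc_Cgen.
Qed.

(** The form of J + sum_q t_q H_q at Gamma v is |x|^2 plus multipliers times the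
defects of the relations alpha_(sigma q) = conj alpha_q. *)
Lemma qform_JH t v :
  qform (JH G lam t) (Gm *m v) = sqn (xvec v) +
  \sum_q t q * (2 * Re (Hcoef q * (alpha v q - Num.conj (alpha v (dual_idx q))))).
Proof.
rewrite (qform_pencil _ _ t) /Jmx qform_conjGam qform_Jtilde; congr (_ + _).
by apply: eq_bigr => q _; rewrite qform_H.
Qed.

(** The coefficients of the real linear form t in the alpha_q; see sum_tau. *)
Definition tau (t : 'I_N -> R) q : C :=
  (t q)%:C * Hcoef q - (t (dual_idx q))%:C * Num.conj (Hcoef (dual_idx q)).

Lemma sum_tau t v :
  \sum_q t q * (2 * Re (Hcoef q * (alpha v q - Num.conj (alpha v (dual_idx q))))) =
  2 * Re (\sum_q tau t q * alpha v q).
Proof.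
under [in RHS]eq_bigr do rewrite /tau mulrBl.
rewrite sumrB [X in _ - X](reindex_inj (inv_inj dual_idxK)) /= -sumrB Re_sum mulr_sumr.
apply: eq_bigr => q _; rewrite dual_idxK mulrCA; congr (2 * _).
rewrite -!mulrA -mulrBr ReZ; congr (_ * _); rewrite mulrBr !ReD !ReN.
by congr (_ - _); rewrite -Re_conj rmorphM /= conjCK.
Qed.

Lemma conj_tau t q : Num.conj (tau t (dual_idx q)) = - tau t q.
Proof. by rewrite /tau dual_idxK rmorphB !rmorphM /= !conj_real conjCK opprB. Qed.

Lemma tau_low t (p : 'I_d.+1) : (2 * p < d)%N ->
  tau t (lshift k p) = t (lshift k p) +i* t (lshift k (rev_ord p)).
Proof.
move=> hp; rewrite /tau dual_idx_l /Hcoef !split_lshift hp; have [-> -> _] := rev_half hp.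
rewrite conj_i mulrN opprK mulr1 [RHS]complexE /=; congr (_ + _).
exact: mulrC.
Qed.

Lemma tau_fix t q : dual_idx q = q -> Hcoef q = 'i%C / 2 -> tau t q = 0 +i* t q.
Proof.
move=> sq cq; rewrite /tau sq cq conj_i_half mulrN opprK -mulrDr -splitr.
by rewrite mulrC [RHS]complexE /= add0r.
Qed.

Lemma tau_eq0 t : (forall q, tau t q = 0) -> forall q, t q = 0.
Proof.
move=> h; apply: dual_idx_ind => [p hp|p hp _|q sq _ cq].
- by have := h (lshift k p); rewrite tau_low // => -[].
- by have := h (lshift k p); rewrite tau_low // => -[].
by have := h q; rewrite tau_fix // => -[].
Qed.

Lemma alpha_sym v : (forall q, qform (Hmx G lam q) (Gm *m v) = 0) ->
  forall q, alpha v (dual_idx q) = Num.conj (alpha v q).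
Proof.
move=> h; have h' q : Re (Hcoef q * (alpha v q - Num.conj (alpha v (dual_idx q)))) = 0.
  by have /eqP := h q; rewrite qform_H mulf_eq0 pnatr_eq0 /= => /eqP.
have sym q : alpha v (dual_idx q) = Num.conj (alpha v q) ->
    alpha v (dual_idx (dual_idx q)) = Num.conj (alpha v (dual_idx q)).
  by rewrite dual_idxK => ->; rewrite conjCK.
apply: dual_idx_ind => [p hp|p hp|q sq _ cq]; last first.
- have := h' q; rewrite cq sq; move: (alpha v q) => a.
  have -> : a - Num.conj a = 2 * (Im a)%:C * 'i%C by exact: subcJ.
  have -> : 'i%C / 2 * (2 * (Im a)%:C * 'i%C) = - (Im a)%:C :> C.
    have i2 : ('i%C * 'i%C : C) = -1 by exact: sqr_i.
    rewrite -[RHS]mulN1r -i2; move: {i2} ((Im a)%:C) ('i%C) => y j.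
    by field.
  case: a => x y /= /eqP; rewrite oppr_eq0 => /eqP y0.
  by apply/eqP; rewrite eq_complex /= y0 oppr0 !eqxx.
- by rewrite -dual_idx_l; exact: sym.
have [r1 r2 _] := rev_half hp.
have := h' (lshift k (rev_ord p)); have := h' (lshift k p).
rewrite !dual_idx_l rev_ordK /Hcoef !split_lshift hp r1 r2 mul1r.
case: (alpha v (lshift k p)) => a b; case: (alpha v _) => c e /=.
rewrite mul0r mul1r => h1 h2; apply/eqP; rewrite eq_complex /=; apply/andP; split; apply/eqP; lra.
Qed.

(** The common shape of the vectors that J and the H_q, stripped of Gamma, produce
from v: modulo x, the block q is conj Lam_q times a vector independent of q. *)
Definition eigen_shape v (w : 'cV[C]_(N * n)) :=
  exists u, forall q, exists kap, block w q = Num.conj (L 0 q) *: u + kap *: xvec v.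

Lemma eigen_shapeD v w1 w2 : eigen_shape v w1 -> eigen_shape v w2 -> eigen_shape v (w1 + w2).
Proof.
move=> [u1 h1] [u2 h2]; exists (u1 + u2) => q.
have [k1 e1] := h1 q; have [k2 e2] := h2 q; exists (k1 + k2).
by rewrite blockD e1 e2 scalerDr scalerDl addrACA.
Qed.

Lemma eigen_shapeZ v w a : eigen_shape v w -> eigen_shape v (a *: w).
Proof.
move=> [u h]; exists (a *: u) => q; have [kap e] := h q; exists (a * kap).
by rewrite blockZ e scalerDr !scalerA [a * Num.conj _]mulrC.
Qed.

Lemma eigen_shape_Cgen a b v : eigen_shape v (Cg a b *m v).
Proof.
exists (adjmx M *m block v a) => q; exists (- (q == b)%:R).
by rewrite block_Cgen scaleNr.
Qed.

Lemma eigen_shape_JH t v : eigen_shape v (Gm *m (JH G lam t *m (Gm *m v))).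
Proof.
have cancel (A : 'M[C]_(N * n)) :
    Gm *m (invmx Gm *m A *m invmx Gm *m (Gm *m v)) = A *m v.
  by rewrite -!mulmxA mulKmx ?Gam_unit // mulKVmx ?Gam_unit.
rewrite /JH mulmxDl mulmx_suml mulmxDr mulmx_sumr; apply: eigen_shapeD.
  rewrite /Jmx cancel; exists (adjmx M *m xvec v) => q; exists 0.
  by rewrite block_Jtilde scale0r addr0.
elim/big_ind: _ => [|w1 w2|q _].
- exists 0 => q; exists 0; rewrite scale0r scaler0 addr0.
  by apply/colP => i; rewrite !mxE.
- exact: eigen_shapeD.
rewrite -scalemxAl -scalemxAr; apply: eigen_shapeZ.
rewrite Hmx_E cancel (mul_skew (Hcoef q)).
by apply: eigen_shapeD; apply: eigen_shapeZ; exact: eigen_shape_Cgen.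
Qed.

(** An eigenvector has the shape above, so l g_q^2 v_q and conj Lam_q u have the
same component orthogonal to x; weight_balance makes these components equally
long at q and at sigma q. *)
Lemma sqn_orth_sym t v (l : R) : 0 < l ->
  JH G lam t *m (Gm *m v) = l%:C *: (Gm *m v) -> xvec v != 0 ->
  forall q, sqn (orth (xvec v) (block v q)) = sqn (orth (xvec v) (block v (dual_idx q))).
Proof.
move=> l0 e x0; have := eigen_shape_JH t v; rewrite e => -[u hu].
have key q : l * weight q ^+ 2 * (l * weight q ^+ 2) * sqn (orth (xvec v) (block v q)) =
    normc (L 0 q) ^+ 2 * sqn (orth (xvec v) u).
  have [kap] := hu q; rewrite -scalemxAr blockZ !block_Gam !scalerA.
  move/(congr1 (orth (xvec v))); rewrite orthD !orthZ (orth_self x0) scaler0 addr0.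
  move/(congr1 (@sqn R n)); rewrite !sqnZ.
  have -> : normc (Num.conj (L 0 q)) ^+ 2 = normc (L 0 q) ^+ 2.
    by case: (L 0 q) => a b /=; rewrite sqrrN.
  by rewrite -!rmorphM normc_real_sq => <-; ring.
move=> q; have [k1 k2] := (key q, key (dual_idx q)).
exact: (balance_cancel l0 (weight_gt0 q) (weight_gt0 (dual_idx q)) (weight_balance q) k1 k2).
Qed.

Definition fam (D : mx_tuple R n d k) (q : 'I_N) : 'M[C]_n :=
  match fintype.split q with inl p => D.1 p | inr j => D.2 j end.

Lemma fam_l D p : fam D (lshift k p) = D.1 p.
Proof. by rewrite /fam split_lshift. Qed.
Lemma fam_r D j : fam D (rshift d.+1 j) = D.2 j.
Proof. by rewrite /fam split_rshift. Qed.

Lemma sum_fam D : \sum_(p < d.+1) lam ^+ p *: D.1 p + \sum_(j < k) rmp_w G j lam *: D.2 j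
  = \sum_q L 0 q *: fam D q.
Proof.
rewrite big_split_ord /=; congr (_ + _); apply: eq_bigr => i _.
  by rewrite Lam_l fam_l.
by rewrite Lam_r fam_r.
Qed.

Lemma pal_star_fam D : pal_star D <-> forall q, adjmx (fam D q) = fam D (dual_idx q).
Proof.
split=> [[h1 h2] q|h].
  case: (split_ordP q) => [p ->|j ->]; first by rewrite dual_idx_l !fam_l.
  by rewrite dual_idx_r !fam_r.
split=> [p|j]; first by have := h (lshift k p); rewrite dual_idx_l !fam_l.
by have := h (rshift d.+1 j); rewrite dual_idx_r !fam_r.
Qed.

Lemma sum_fam_fun D (f : 'M[C]_n -> R) :
  \sum_(p < d.+1) f (D.1 p) + \sum_(j < k) f (D.2 j) = \sum_q f (fam D q).
Proof.
rewrite big_split_ord /=; congr (_ + _); apply: eq_bigr => i _.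
  by rewrite fam_l.
by rewrite fam_r.
Qed.

Lemma tuple_norm_sq D : tuple_norm D ^+ 2 = \sum_q spectral_norm (fam D q) ^+ 2.
Proof.
rewrite sqr_sqrtr; last by rewrite addr_ge0 // sumr_ge0 // => i _; exact: sqr_ge0.
exact: (sum_fam_fun D (fun A => spectral_norm A ^+ 2)).
Qed.

(** Average the sum with its image under sigma and use g_q^2 + g_(sigma q)^2 = 2. *)
Lemma sum_weight (F : 'I_N -> R) : (forall q, F (dual_idx q) = F q) ->
  \sum_q weight q ^+ 2 * F q = \sum_q F q.
Proof.
move=> h; have e : \sum_q weight q ^+ 2 * F q = \sum_q weight (dual_idx q) ^+ 2 * F q.
  by rewrite (reindex_inj (inv_inj dual_idxK)) /=; apply: eq_bigr => q _; rewrite h.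
apply: (@mulfI _ 2) => //; rewrite mulr2n mulrDl mul1r {2}e -big_split mulr_sumr /=.
by apply: eq_bigr => q _; rewrite -mulrDl weight_sqD.
Qed.

Lemma sqn_Gam v : sqn (Gm *m v) = \sum_q weight q ^+ 2 * sqn (block v q).
Proof.
rewrite sqn_block; apply: eq_bigr => q _.
by rewrite block_Gam sqnZ normc_real_sq.
Qed.

Lemma GamVK (w : 'cV[C]_(N * n)) : Gm *m (invmx Gm *m w) = w.
Proof. by rewrite mulKVmx ?Gam_unit. Qed.

Lemma rmp_eval_fam : rmp_eval G lam = \sum_q L 0 q *: fam (rmp_A G, rmp_E G) q.
Proof. exact: (sum_fam (rmp_A G, rmp_E G)). Qed.

Lemma det_fam D :
  \sum_(p < d.+1) lam ^+ p *: (rmp_A G p - D.1 p) +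
  \sum_(j < k) rmp_w G j lam *: (rmp_E G j - D.2 j) =
  rmp_eval G lam - \sum_q L 0 q *: fam D q.
Proof.
rewrite -sum_fam /rmp_eval opprD addrACA -!sumrB.
by congr (_ + _); apply: eq_bigr => i _; rewrite scalerBr.
Qed.

Hypothesis G_unit : rmp_eval G lam \in unitmx.

Lemma lower_bound D t : pal_star D ->
  \det (\sum_(p < d.+1) lam ^+ p *: (rmp_A G p - D.1 p) +
        \sum_(j < k) rmp_w G j lam *: (rmp_E G j - D.2 j)) = 0 ->
  0 < lambda_max (JH G lam t) /\ 1 <= lambda_max (JH G lam t) * tuple_norm D ^+ 2.
Proof.
rewrite det_fam => /pal_star_fam hD /det0_kernel [x x0].
rewrite mulmxBl => /eqP; rewrite subr_eq0 => /eqP Gx.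
pose v := unblock (fun q => fam D q *m x).
have vq q : block v q = fam D q *m x by exact: unblockK.
have xv : xvec v = x.
  rewrite /xvec /lamsum (eq_bigr (fun q => (L 0 q *: fam D q) *m x)).
    by rewrite -mulmx_suml -Gx mulKmx.
  by move=> q _; rewrite vq scalemxAl.
have qf : qform (JH G lam t) (Gm *m v) = sqn x.
  rewrite qform_JH xv big1 ?addr0 // => q _.
  suff -> : Num.conj (alpha v (dual_idx q)) = alpha v q by rewrite subrr mulr0 /= !mulr0.
  by rewrite /alpha xv !vq dotc_conj -hD [RHS]dotc_adj.
have xp : 0 < sqn x by rewrite sqn_gt0.
have := qform_le_lambda_max (Gm *m v) Nn_gt0 (herm_JH t); rewrite qf => h.
have lp : 0 < lambda_max (JH G lam t).
  have := lt_le_trans xp h; have := sqn_ge0 (Gm *m v).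
  rewrite le_eqVlt => /orP [/eqP <-|g0]; first by rewrite mulr0 ltxx.
  by rewrite pmulr_lgt0.
split=> //; rewrite -(ler_pM2r xp) mul1r; apply: le_trans h _.
have hs q : spectral_norm (fam D (dual_idx q)) ^+ 2 = spectral_norm (fam D q) ^+ 2.
  by rewrite -hD; exact: (spectral_norm_adj (fam D q) n_gt0 n_gt0).
rewrite -mulrA ler_wpM2l ?(ltW lp) // tuple_norm_sq sqn_Gam -(sum_weight hs).
rewrite mulr_suml; apply: ler_sum => q _.
rewrite vq -[leRHS]mulrA; apply: ler_wpM2l; first exact: sqr_ge0.
exact: spectral_norm_bound.
Qed.

Lemma upper_bound t (w : 'cV[C]_(N * n)) : let l := lambda_max (JH G lam t) in
  0 < l -> sqn w = 1 -> JH G lam t *m w = l%:C *: w ->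
  (forall q, qform (Hmx G lam q) w = 0) ->
  exists D, [/\ pal_star D,
   \det (\sum_(p < d.+1) lam ^+ p *: (rmp_A G p - D.1 p) +
        \sum_(j < k) rmp_w G j lam *: (rmp_E G j - D.2 j)) = 0 &
   tuple_norm D ^+ 2 <= l^-1].
Proof.
move=> l l0 w1 ew hw; pose v := invmx Gm *m w.
have vw : Gm *m v = w by exact: GamVK.
clearbody v; have sym := @alpha_sym v; rewrite vw in sym; have {}sym := sym hw.
have xl : sqn (xvec v) = l.
  have := qform_JH t v; rewrite vw (qform_eigen ew) w1 mulr1 big1 ?addr0 //.
  by move=> q _; rewrite sym conjCK subrr mulr0 /= !mulr0.
have x0 : xvec v != 0 by rewrite -sqn_gt0 xl.
have os : forall q, sqn (orth (xvec v) (block v q)) = sqn (orth (xvec v) (block v (dual_idx q))).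
  by apply: (sqn_orth_sym l0) x0; rewrite vw; exact: ew.
have ss q : sqn (block v (dual_idx q)) = sqn (block v q).
  apply: (eq_sqn_orth x0); last exact: esym (os q).
  rewrite [dotc _ (block v (dual_idx q))](sym q) /alpha.
  by case: (dotc _ _) => a b /=; rewrite sqrrN.
pose F q := interp (xvec v) (block v q) (block v (dual_idx q)).
pose D : mx_tuple R n d k := (fun p => F (lshift k p), fun j => F (rshift d.+1 j)).
have DF q : fam D q = F q.
  by rewrite /fam; case: (split_ordP q) => [p ->|j ->]; rewrite ?split_lshift ?split_rshift.
exists D; split.
- apply/pal_star_fam => q; rewrite !DF /F dual_idxK; apply: interp_adj => //; exact: sym.
- rewrite det_fam; apply/det0_kernel; exists (xvec v) => //.
  rewrite mulmxBl mulmx_suml; apply/eqP; rewrite subr_eq0 /xvec mulKVmx //.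
  apply/eqP; rewrite {1}/lamsum; apply: eq_bigr => q _.
  by rewrite -scalemxAl DF /F interp_dom.
rewrite tuple_norm_sq; apply: (@le_trans _ _ (\sum_q sqn (block v q) / l)).
  apply: ler_sum => q _; apply: spectral_norm_le => // y.
  by rewrite DF /F -xl; apply: interp_bound => //; exact: sym.
by rewrite -mulr_suml -(sum_weight ss) -sqn_Gam vw w1 mul1r.
Qed.

Hypothesis palG : pal_star (rmp_A G, rmp_E G).

Local Notation q0 := (lshift k ord0 : 'I_N).

Lemma Lam_q0 : L 0 q0 = 1.
Proof. by rewrite Lam_l expr0. Qed.

(** If tau is not proportional to Lam, then sum_q Lam_q v_q and sum_q tau_q v_q
can be prescribed independently: choose v with x fixed and sum_q tau_q v_q = x. *)
Lemma tau_positive t q : tau t q != tau t q0 * L 0 q ->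
  exists v, 0 < \sum_r t r * qform (Hmx G lam r) (Gm *m v).
Proof.
move=> tq; pose D := tau t q - tau t q0 * L 0 q.
have D0 : D != 0 by rewrite subr_eq0.
have qq0 : q != q0 by apply: contraNneq tq => ->; rewrite Lam_q0 mulr1.
have x0 : (const_mx 1 : 'cV[C]_n) != 0.
  by apply/eqP => /colP/(_ (Ordinal n_gt0)) /eqP; rewrite !mxE oner_eq0.
move: (const_mx 1) x0 => x x0.
(* The blocks at 0 and q, the others being zero, solve the 2 x 2 system
   sum_r Lam_r v_r = G(lam) x, sum_r tau_r v_r = x. *)
pose y := rmp_eval G lam *m x; pose z := D^-1 *: (x - tau t q0 *: y).
pose v := unblock (fun r => if r == q0 then y - L 0 q *: z else if r == q then z else 0).
have sumv (c : 'I_N -> C) : \sum_r c r *: block v r = c q0 *: (y - L 0 q *: z) + c q *: z.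
  rewrite (bigD1 q0) //= (bigD1 q) //= big1 => [|r /andP[/negPf r0 /negPf rq]].
    by rewrite !unblockK eqxx (negPf qq0) eqxx addr0.
  by rewrite unblockK r0 rq scaler0.
have wv : lamsum v = y by rewrite /lamsum sumv Lam_q0 scale1r subrK.
have xv : xvec v = x by rewrite /xvec wv mulKmx.
exists v; under eq_bigr do rewrite qform_H.
rewrite sum_tau; have -> : \sum_r tau t r * alpha v r = (sqn x)%:C.
  rewrite -dotcc /alpha xv.
  under eq_bigr do rewrite -dotcZr.
  rewrite -dotc_sumr sumv; congr dotc.
  rewrite scalerBr scalerA addrAC -addrA -scalerBl -/D /z scalerA mulfV // scale1r.
  by rewrite addrC subrK.
by rewrite /= mulr_gt0 // sqn_gt0.
Qed.

Lemma dual_idx_deg0 : d = 0%N -> forall q, dual_idx q = q /\ Hcoef q = 'i%C / 2.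
Proof.
move=> d0; apply: dual_idx_ind => [p hp|p hp _|q -> _ -> //].
  by have := leq_trans hp (eq_leq d0); rewrite ltn0.
by have := leq_trans hp (eq_leq d0); rewrite ltn0.
Qed.

(** The only situation in which some t <> 0 gives a combination sum_q t_q H_q
without positive eigenvalue. *)
Definition degenerate := d = 0%N /\ forall q, Im (L 0 q) = 0.

Hypothesis lam_norm : normc lam != 1.

(** Compare tau_d = tau_0 lam^d with tau_d = - conj tau_0: the moduli give
|lam|^d = 1, so d = 0.  Then sigma is the identity, all tau_q are purely
imaginary, and Lam_q = tau_q / tau_0 is real. *)
Lemma tau_parallel t : (forall q, tau t q = tau t q0 * L 0 q) ->
  tau t q0 != 0 -> degenerate.
Proof.
move=> par c0; have d0 : d = 0%N.
  have := conj_tau t q0; rewrite (par (dual_idx q0)) dual_idx_l Lam_l => /(congr1 (@normc R)).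
  have nJ (a : C) : normc (Num.conj a) = normc a by case: a => a b /=; rewrite sqrrN.
  rewrite nJ normcN normcM normcX -[RHS]mulr1 => /(mulfI _) /=.
  rewrite subn1 /= => h; have /eqP : normc lam ^+ d = 1.
    by apply: h; rewrite gt_eqF // normc_gt0.
  case: (posnP d) => // dp; rewrite pexpr_eq1 //; last by rewrite ltW // normc_gt0.
  by rewrite (negPf lam_norm).
split=> // q; have := conj_tau t q; have := conj_tau t q0.
have [-> _] := dual_idx_deg0 d0 q; have [-> _] := dual_idx_deg0 d0 q0.
rewrite (par q) rmorphM /= => ->; rewrite mulNr => /oppr_inj /(mulfI c0).
case: (L 0 q) => a b [] /eqP; rewrite -subr_eq0 -opprD oppr_eq0 -mulr2n.
by rewrite mulrn_eq0 /= => /eqP.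
Qed.

Lemma degenerate_herm : degenerate -> hermitianmx (rmp_eval G lam).
Proof.
move=> [d0 Lr]; rewrite /hermitianmx rmp_eval_fam adjmx_sum; apply: eq_bigr => q _.
have /pal_star_fam palf := palG.
rewrite adjmxZ palf (dual_idx_deg0 d0 q).1; congr (_ *: _).
by have := Lr q; case: (L 0 q) => a b /= ->; apply/eqP; rewrite eq_complex /= oppr0 !eqxx.
Qed.

(** For t = a Lam the form is 2 Re (i a <x, G(lam) x>), and G(lam) is Hermitian. *)
Lemma degenerate_sum (a : R) v : degenerate ->
  \sum_r (a * Re (L 0 r)) * qform (Hmx G lam r) (Gm *m v) = 0.
Proof.
move=> deg; have hG := degenerate_herm deg; have [d0 Lr] := deg.
under eq_bigr do rewrite qform_H.
rewrite (sum_tau (fun r => a * Re (L 0 r))).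
have -> : \sum_q tau (fun r => a * Re (L 0 r)) q * alpha v q =
    'i%C * a%:C * dotc (xvec v) (rmp_eval G lam *m xvec v).
  rewrite {2}/xvec mulKVmx // /lamsum dotc_sumr mulr_sumr; apply: eq_bigr => q _.
  rewrite dotcZr mulrA; congr (_ * _).
  have [sq cq] := dual_idx_deg0 d0 q; rewrite tau_fix //.
  have := Lr q; case: (L 0 q) => x y /= ->.
  by apply/eqP; rewrite eq_complex /=; apply/andP; split; apply/eqP; ring.
have : Num.conj (dotc (xvec v) (rmp_eval G lam *m xvec v)) =
    dotc (xvec v) (rmp_eval G lam *m xvec v).
  by rewrite dotc_conj [RHS]dotc_adj hG.
case: (dotc _ _) => x y [] /eqP; rewrite -subr_eq0 -opprD oppr_eq0 -mulr2n.
rewrite mulrn_eq0 /= => /eqP ->.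
ring.
Qed.

Lemma lambda_max_eq (s t : 'I_N -> R) :
  (forall v, qform (JH G lam s) (Gm *m v) = qform (JH G lam t) (Gm *m v)) ->
  lambda_max (JH G lam s) = lambda_max (JH G lam t).
Proof.
move=> h; apply/eqP; rewrite eq_le; apply/andP; split.
  apply: (lambda_max_le Nn_gt0 (herm_JH s)) => w.
  rewrite -(GamVK w) h; exact: (qform_le_lambda_max _ Nn_gt0 (herm_JH t)).
apply: (lambda_max_le Nn_gt0 (herm_JH t)) => w.
rewrite -(GamVK w) -h; exact: (qform_le_lambda_max _ Nn_gt0 (herm_JH s)).
Qed.

(** Minimize over all t, or over t_0 = 0 in the degenerate case: subtracting the
multiple s_0 Lam of the constant direction brings any s into that slice. *)
Lemma JH_minimizer : exists t : 'I_N -> R, forall s : 'I_N -> R,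
  lambda_max (JH G lam t) <= lambda_max (JH G lam s).
Proof.
(* Lam_0 = 1, so t_0 = 0 cuts out a complement of the line spanned by Lam. *)
pose T : set 'rV[R]_N := [set t | degenerate -> t 0 q0 = 0].
have J0 (v : 'cV[C]_(N * n)) : 0 <= qform (Jmx G lam) v.
  by rewrite -(GamVK v) qform_conjGam qform_Jtilde sqn_ge0.
have T0 : T 0 by move=> _; rewrite mxE.
have TZ a t : T t -> T (a *: t) by move=> h dg; rewrite mxE h // mulr0.
have Tc : closed T.
  have [dg|ndg] := pselect degenerate; last first.
    rewrite (_ : T = setT); first exact: closedT.
    by apply/seteqP; split => // t _ /ndg.
  rewrite (_ : T = (fun t : 'rV[R]_N => t 0 q0) @^-1` [set x | x = 0]); last first.
    by apply/seteqP; split => t /= h; [exact: h | move=> _].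
  apply: closed_comp; last exact: closed_eq.
  move=> t _; apply: (@lipschitz_rV_continuous R N _ 1) => {}t s.
  have := entry_le_norm (t - s) q0; rewrite !mxE mul1r => h.
  by rewrite -lerBlDl; apply: le_trans (ler_norm _) h.
have Tpos (t : 'rV[R]_N) : T t -> t != 0 ->
    exists v, 0 < \sum_i t 0 i * qform (Hmx G lam i) v.
  move=> Tt t0; have [[q tq]|par] := pselect (exists q, tau (t 0) q != tau (t 0) q0 * L 0 q).
    by have [v hv] := tau_positive tq; exists (Gm *m v).
  have {}par q : tau (t 0) q = tau (t 0) q0 * L 0 q.
    by apply/eqP; apply: contra_notT par => h; exists q.
  have c0 : tau (t 0) q0 = 0.
    apply/eqP; apply: contraT => c0; have dg := tau_parallel par c0.
    have [d0 _] := dg; have [s0 f0] := dual_idx_deg0 d0 q0.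
    by move: c0; rewrite tau_fix // Tt // eqxx.
  case/eqP: t0; apply/rowP => q; rewrite mxE.
  by apply: (@tau_eq0 (t 0)) => r; rewrite par c0 mul0r.
have [t Tt tP] := lambda_max_pencil_min Nn_gt0 herm_J herm_H J0 T0 Tc TZ Tpos.
exists (fun i => t 0 i) => s.
have [dg|ndg] := pselect degenerate; last first.
  have := tP (\row_i s i) (fun dg => False_ind _ (ndg dg)).
  by rewrite (_ : (fun i => (\row_j s j) 0 i) = s) //; apply/funext => i; rewrite mxE.
pose s' i := s i - s q0 * Re (L 0 i).
have -> : lambda_max (JH G lam s) = lambda_max (JH G lam s').
  apply: lambda_max_eq => v; rewrite !qform_pencil; congr (_ + _).
  rewrite /s' [RHS](eq_bigr _ (fun i _ => mulrBl _ _ _)) sumrB.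
  by rewrite degenerate_sum // subr0.
have := tP (\row_i s' i) _; rewrite (_ : (fun i => (\row_j s' j) 0 i) = s').
  by apply; move=> _; rewrite mxE /s' Lam_q0 /= mulr1 subrr.
by apply/funext => i; rewrite mxE.
Qed.

Lemma JH_shift t q (a : R) :
  JH G lam t + a%:C *: Hmx G lam q = JH G lam (fun i => t i + (if i == q then a else 0)).
Proof.
rewrite /JH -addrA; congr (_ + _); rewrite [RHS](bigD1 q) //= [X in X + _](bigD1 q) //= eqxx.
rewrite rmorphD scalerDl -!addrA; congr (_ + _); rewrite addrC; congr (_ + _).
by apply: eq_bigr => i /negPf ->; rewrite addr0.
Qed.

End Palindromic.

(** * The backward error *)

Theorem theorem6p2 (R : realType) (n d k : nat) (G : rmp R n d k) (lam : R[i]) :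
  (0 < n)%N ->
  star_palindromic G ->
  lam != 0 ->
  `|lam| != 1 ->
  ~ is_pole G lam ->
  (forall j : 'I_k, rmp_w G j lam != 0) ->
  rmp_eval G lam \in unitmx ->
  let eta := backward_error (@pal_star R n d k) G lam in
  let is_minimizer (t : 'I_(d.+1 + k) -> R) :=
    forall s : 'I_(d.+1 + k) -> R,
      lambda_max (JH G lam t) <= lambda_max (JH G lam s) in
  (exists t : 'I_(d.+1 + k) -> R, is_minimizer t) /\
  (forall t : 'I_(d.+1 + k) -> R, is_minimizer t ->
     let lhat := lambda_max (JH G lam t) in
     [/\ 0 < lhat,
         ((1 / Num.sqrt lhat)%:E <= eta)%E
       & simple_eigenvalue (JH G lam t) lhat%:C ->
           eta = (1 / Num.sqrt lhat)%:E]).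
Proof.
move=> n0 [palG _] lam0 lam1 _ _ Gu eta is_minimizer.
have lamn : normc lam != 1.
  by apply: contraNneq lam1 => h; apply/eqP; rewrite -[LHS]/((normc lam)%:C) h.
split; first exact: (JH_minimizer lam0 n0 Gu palG lamn).
move=> t tmin lhat.
(* The tuple (A, E) itself is admissible. *)
have det0 : \det (\sum_(p < d.+1) lam ^+ p *: (rmp_A G p - rmp_A G p) +
        \sum_(j < k) rmp_w G j lam *: (rmp_E G j - rmp_E G j)) = 0.
  rewrite !big1 => [|i _|i _]; rewrite ?subrr ?scaler0 // addr0.
  apply/det0_kernel; exists (const_mx 1); last by rewrite mul0mx.
  by apply/eqP => /colP/(_ (Ordinal n0)) /eqP; rewrite !mxE oner_eq0.
have [l0 _] := lower_bound lam0 n0 Gu t palG det0.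
have lowE : ((1 / Num.sqrt lhat)%:E <= eta)%E.
  apply: le_ereal_inf_tmp => _ [D [palD detD] <-]; rewrite lee_fin.
  have [_ h] := lower_bound lam0 n0 Gu t palD detD.
  apply: le_of_sqr; first exact: sqrtr_ge0.
  rewrite expr_div_n expr1n sqr_sqrtr ?(ltW l0) // ler_pdivrMr //.
  by rewrite mulrC.
have N0 : (0 < (d.+1 + k) * n)%N by rewrite muln_gt0.
split => // /(simple_top_stationary N0 (herm_JH G lam0 n0 t)).
move=> [w [w1 ew hw]].
have [|D [palD detD nD]] := upper_bound lam0 n0 Gu l0 w1 ew.
  move=> q; apply: hw => [|a]; first exact: herm_H.
  by rewrite JH_shift; exact: tmin.
apply/le_anti/andP; split => //.
apply: (@le_trans _ _ (tuple_norm D)%:E); first by apply: ereal_inf_lbound; exists D.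
rewrite lee_fin; apply: le_of_sqr; first by rewrite divr_ge0 // sqrtr_ge0.
by move: (tuple_norm D) nD => N nD; rewrite div1r exprVn sqr_sqrtr // ltW.
Qed.
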